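(* Let $x$ be a quantum graph. Then $x\ge 0$ if and only if for every $\varepsilon>0$ there exist $k\ge1$ and $k$-labeled quantum graphs $y_1,\dots,y_m$ such that $\|x-y_1^2-\dots-y_m^2\|_1<\varepsilon$.
   Context: All graphs are finite and simple. A quantum graph is a formal finite real linear combination of graphs; throughout, graphs that become isomorphic after deleting their isolated nodes are identified, so a quantum graph is a finitely supported real vector $(\alpha_F)$ indexed by isomorphism classes of graphs without isolated nodes (including the empty graph), and $\|\sum_F\alpha_F F\|_1=\sum_F|\alpha_F|$. $\mathcal{W}_0$ is the set of symmetric measurable $W:[0,1]^2\to[0,1]$, and $t(F,W)=\int_{[0,1]^{V(F)}}\prod_{ij\in E(F)}W(x_i,x_j)\prod_{i\in V(F)}dx_i$ (this is unchanged by adding isolated nodes to $F$). For $x=\sum_i\alpha_iF_i$ we write $x\ge0$ if $\sum_i\alpha_it(F_i,W)\ge0$ for every $W\in\mathcal{W}_0$. A $k$-labeled graph is a graph in which $k$ nodes are labeled $1,\dots,k$ (other nodes unlabeled); for $k$-labeled graphs $F_1,F_2$, the product $F_1F_2$ is obtained from their disjoint union by identifying nodes with the same label (keeping a single copy of any multiple edge). A $k$-labeled quantum graph is a formal finite real linear combination of $k$-labeled graphs, and the product extends bilinearly. For a $k$-labeled quantum graph $y$, $y^2$ denotes the quantum graph obtained by computing $y\cdot y$ and then forgetting the labels. *)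

(* Defs.v *)
From HB Require Import structures.
From mathcomp Require Import all_boot all_order all_algebra.
From mathcomp Require Import all_classical all_reals all_analysis.

Set Implicit Arguments.
Unset Strict Implicit.
Unset Printing Implicit Defensive.

Import Order.TTheory GRing.Theory Num.Theory.
Local Open Scope classical_set_scope.
Local Open Scope ring_scope.

(* A graph has vertex set 'I_n and is given by a set of (ordered)      *)
(* pairs; the simple graph it denotes has i ~ j iff i <> j and (i,j)   *)
(* or (j,i) is listed.  Every simple graph on 'I_n arises this way.    *)
Record graph := Graph { gsize : nat; gedges : {set 'I_gsize * 'I_gsize} }.

Definition adj (G : graph) (i j : 'I_(gsize G)) : bool :=
  (i != j) && (((i, j) \in gedges G) || ((j, i) \in gedges G)).
Arguments adj : clear implicits.

Definition nonisolated (G : graph) (i : 'I_(gsize G)) : bool :=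
  [exists j, adj G i j].
Arguments nonisolated : clear implicits.

(* G and H are isomorphic after deleting isolated nodes: there is a
   bijection P (given as its graph) between the non-isolated nodes of G
   and those of H preserving adjacency. *)
Definition gequiv (G H : graph) : bool :=
  [exists P : {set 'I_(gsize G) * 'I_(gsize H)},
    [&& [forall p in P, nonisolated G p.1 && nonisolated H p.2],
        [forall i, nonisolated G i ==> (#|[set j | (i, j) \in P]| == 1%N)],
        [forall j, nonisolated H j ==> (#|[set i | (i, j) \in P]| == 1%N)] &
        [forall p in P, forall q in P, adj G p.1 q.1 == adj H p.2 q.2]]].

Definition qgraph (R : realType) := seq (R * graph).

Definition qsub (R : realType) (x y : qgraph R) : qgraph R :=
  x ++ [seq (- p.1, p.2) | p <- y].

Definition qcoef (R : realType) (x : qgraph R) (F : graph) : R :=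
  \sum_(p <- x | gequiv p.2 F) p.1.

(* l1 norm: sum over the distinct classes occurring in x (first
   representative of each class) of |coefficient| *)
Definition qnorm1 (R : realType) (x : qgraph R) : R :=
  \sum_(i < size x | [forall j : 'I_(size x),
                        (j < i)%N ==> ~~ gequiv (nth (0, @Graph 0 finset.set0) x j).2
                                               (nth (0, @Graph 0 finset.set0) x i).2])
     `| qcoef x (nth (0, @Graph 0 finset.set0) x i).2 |.

(* W0: symmetric measurable functions with values in [0,1]. A function
   on [0,1]^2 is represented by any extension to R x R (e.g. by 0). *)
Definition graphon (R : realType) (W : R * R -> R) : Prop :=
  [/\ measurable_fun [set: R * R] W,
      (forall x y, W (x, y) = W (y, x)) &
      (forall x y, 0 <= W (x, y) <= 1)].

(* iterated Lebesgue integral over [0,1]^n of f; coordinate i of the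
   point is v i (for i < n). By Tonelli it equals the integral over
   [0,1]^n for nonnegative measurable integrands. *)
Fixpoint iint (R : realType) (n : nat) (f : (nat -> R) -> \bar R) : \bar R :=
  match n with
  | 0 => f (fun _ => 0)
  | n'.+1 => (\int[@lebesgue_measure R]_(t in `[0%R, 1%R]%classic)
               iint n' (fun v => f (fun i => if i == n' then t else v i)))%E
  end.

Definition hom_density (R : realType) (F : graph) (W : R * R -> R) : R :=
  fine (iint (gsize F) (fun v =>
    (\prod_(i : 'I_(gsize F)) \prod_(j : 'I_(gsize F) | (i < j)%N && adj F i j)
        W (v (val i), v (val j)))%:E)).

Definition qeval (R : realType) (x : qgraph R) (W : R * R -> R) : R :=
  \sum_(p <- x) p.1 * hom_density p.2 W.

Definition qnonneg (R : realType) (x : qgraph R) : Prop :=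
  forall W, graphon W -> 0 <= qeval x W.

(* k-labeled graphs: vertex set 'I_(k + m), nodes 0..k-1 carry labels  *)
(* 1..k, the other m nodes are unlabeled.                              *)
Record lgraph (k : nat) := LGraph { lfree : nat; ledges : {set 'I_(k + lfree) * 'I_(k + lfree)} }.

Definition unlabel k (F : lgraph k) : graph := @Graph (k + lfree F) (ledges F).

Definition emb1 k m1 m2 (i : 'I_(k + m1)) : 'I_(k + m1 + m2) := lshift m2 i.

Definition emb2 k m1 m2 (i : 'I_(k + m2)) : 'I_(k + m1 + m2) :=
  match fintype.split i with
  | inl a => lshift m2 (lshift m1 a)
  | inr b => rshift (k + m1) b
  end.

(* product: disjoint union with equally labeled nodes identified; edge
   sets are united, so multiple edges collapse to one *)
Definition lmul k (F1 F2 : lgraph k) : lgraph k :=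
  @LGraph k (lfree F1 + lfree F2)
    (ecast n ({set 'I_n * 'I_n}) (esym (addnA k (lfree F1) (lfree F2)))
      ([set (emb1 (lfree F2) p.1, emb1 (lfree F2) p.2) | p in ledges F1] :|:
       [set (emb2 (lfree F1) p.1, emb2 (lfree F1) p.2) | p in ledges F2])).

Definition lqgraph (R : realType) (k : nat) := seq (R * lgraph k).

Definition lqsquare (R : realType) k (y : lqgraph R k) : qgraph R :=
  [seq (p.1 * q.1, unlabel (lmul p.2 q.2)) | p <- y, q <- y].

Definition sum_squares (R : realType) k (ys : seq (lqgraph R k)) : qgraph R :=
  flatten [seq lqsquare y | y <- ys].

(* Main.v *)
(* If [x >= 0], put [x] on [K] labeled nodes: averaging every constituent [F]
   over all maps [V(F) -> [K]] moves [x] by O(1/K) in the l1 norm, because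
   injective maps reproduce [F].  Labeled graphs on exactly [K] nodes multiply
   by union of edge sets, so they span an algebra with a basis of idempotents
   [sum_(S contains H) (-1)^|S - H| S], and the coefficient of the averaged [x] on
   the idempotent of [H] is the value of [x] at the step graphon of [H], which
   is nonnegative.  Hence the averaged [x] is exactly a sum of squares.

   Conversely [|x|] at a graphon is at most the l1 norm, and a square is
   nonnegative at every graphon: replacing each value of [W] on a pair of
   labeled nodes by an independent coin flip undoes the merging of multiple
   edges, and what remains is a mean of genuine squares. *)
Require Import Defs.
From mathcomp Require Import all_boot all_order all_algebra.
From mathcomp Require Import all_classical all_reals all_analysis.
From mathcomp Require Import measurable_realfun zify ring lra.
Import Order.TTheory GRing.Theory Num.Theory.
Set Implicit Arguments.
Unset Strict Implicit.
Unset Printing Implicit Defensive.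
Local Open Scope ring_scope.

(** * Iterated integration over coordinates *)

(** Merging multiple edges is the obstacle in the converse: an edge present in both factors of a
    labeled product contributes W(e), whereas multiplying the two densities would give W(e)^2. Only
    edges between two labels can be shared, so everything touching an unlabeled node splits off as
    honest factors, and coins are needed on labeled pairs alone.

    In the other direction the union algebra is never built. The coefficient at a class F is
    governed by one function of edge sets, w(S) = 1 if S lies in the class of F and 0 otherwise; the
    idempotent law and the comparison with x become identities of finite sums in w. There is one
    root per edge set H, scaled by the square root of the value of x at the step graphon of H.

    The rate comes from collisions: a map from n nodes to K labels fails to be injective with
    probability at most n^2/K, and a failure costs its coefficient twice, once for F and once for
    its image. *)

Section Coordinates.
Context {R : realType} (P : probability (measurableTypeR R) R).
Implicit Types (f g : (nat -> R) -> R) (v w : nat -> R) (i j : nat).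

Definition upd v i (t : R) : nat -> R := fun j => if j == i then t else v j.

Lemma upd_id v i t : upd v i t i = t.
Proof. by rewrite /upd eqxx. Qed.

Lemma upd_neq v i j t : j != i -> upd v i t j = v j.
Proof. by rewrite /upd => /negbTE ->. Qed.

Lemma updC v i j s t : i != j -> upd (upd v i s) j t = upd (upd v j t) i s.
Proof.
move=> ij; apply/funext => k; rewrite /upd; case: (eqVneq k j) => [->|//].
by rewrite eq_sym (negbTE ij).
Qed.

(* Testing against all measurable families of coordinates amounts to
   measurability for the product sigma-algebra on [nat -> R]. *)
Definition nice f :=
  (forall v, 0 <= f v <= 1) /\
  forall d (T : measurableType d) (x : T -> nat -> R),
    (forall i, measurable_fun [set: T] (fun s => x s i)) ->
    measurable_fun [set: T] (fun s => f (x s)).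

Lemma nice_upd f v i : nice f -> measurable_fun [set: measurableTypeR R] (fun t => f (upd v i t)).
Proof.
move=> [_ mf]; apply: mf => j; rewrite /upd.
by case: (j == i); [exact: measurable_id|exact: measurable_cst].
Qed.

Lemma nice_int f v i : nice f ->
  P.-integrable [set: measurableTypeR R] (EFin \o (fun t => f (upd v i t))).
Proof.
move=> nf; apply: (measurable_bounded_integrable measurableT).
- by rewrite (le_lt_trans (probability_le1 P _))// ltry.
- exact: nice_upd.
- exists 1; split=> // M M1 t _ /=.
  have /andP[f0 f1] := nf.1 (upd v i t).
  by rewrite ger0_norm// (le_trans f1)// ltW.
Qed.

Definition cint i f v : R := (\int[P]_t f (upd v i t))%R.

Lemma cint_EFin i f v : nice f ->
  (cint i f v)%:E = (\int[P]_t (f (upd v i t))%:E)%E.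
Proof. by move=> nf; rewrite fineK//; exact/integrable_fin_num/nice_int. Qed.

Lemma nice_cint i f : nice f -> nice (cint i f).
Proof.
move=> nf; split=> [v|d T x mx].
  apply/andP; split; first by apply: Rintegral_ge0 => t _; case/andP: (nf.1 (upd v i t)).
  have -> : 1 = (\int[P]_(t in setT) (1 : R))%R :> R.
    by rewrite Rintegral_cst// mul1r; have /= -> := @probability_setT _ _ _ P.
  apply: le_Rintegral => //; first exact: nice_int.
    exact: finite_measure_integrable_cst.
  by move=> t _; case/andP: (nf.1 (upd v i t)).
(* The integration variable joins the parameter space: [nice] tests every measurable family, so
   [T * R] is admissible and Tonelli makes the partial integral measurable. *)
have m2 : measurable_fun [set: T * measurableTypeR R] (fun p : T * measurableTypeR R => (f (upd (x p.1) i p.2))%:E).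
  apply/measurable_EFinP; apply: (nf.2 _ _ (fun p : T * measurableTypeR R => upd (x p.1) i p.2)) => j.
  rewrite /upd; case: (j == i); first exact: measurable_snd.
  exact: (measurableT_comp (mx j) measurable_fst).
have p2 p : (0 <= (f (upd (x p.1) i p.2))%:E)%E.
  by rewrite lee_fin; case/andP: (nf.1 (upd (x p.1) i p.2)).
have mF := measurable_fun_fubini_tonelli_F (m2 := P) _ m2 p2.
apply/measurable_EFinP; apply: eq_measurable_fun mF => s _ /=.
by rewrite cint_EFin.
Qed.

Lemma cintC i j f : nice f -> cint i (cint j f) = cint j (cint i f).
Proof.
move=> nf; case: (eqVneq i j) => [->//|ij]; apply/funext => v.
apply: EFin_inj; rewrite (cint_EFin i v (nice_cint j nf)) (cint_EFin j v (nice_cint i nf)).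
under eq_integral do rewrite cint_EFin//.
under [RHS]eq_integral do rewrite cint_EFin//.
pose h (p : measurableTypeR R * measurableTypeR R) := (f (upd (upd v i p.1) j p.2))%:E.
have mh : measurable_fun [set: measurableTypeR R * measurableTypeR R] h.
  apply/measurable_EFinP; apply: (nf.2 _ _ (fun p : measurableTypeR R * measurableTypeR R => upd (upd v i p.1) j p.2)) => k.
  rewrite /upd; case: (k == j); first exact: measurable_snd.
  by case: (k == i); [exact: measurable_fst|exact: measurable_cst].
rewrite (fubini_tonelli (m1 := P) (m2 := P) h mh).
  by apply: eq_integral => t _; apply: eq_integral => s _; rewrite /h updC.
by move=> p; rewrite lee_fin; case/andP: (nf.1 (upd (upd v i p.1) j p.2)).
Qed.

(** The coefficients may be negative, so the combination itself need not be [nice]; linearity rests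
    on integrability of the single terms. *)
Lemma cint_sum (I : Type) (r : seq I) (c : I -> R) (F : I -> (nat -> R) -> R) i :
  (forall a, nice (F a)) ->
  cint i (fun v => \sum_(a <- r) c a * F a v) =
  fun v => \sum_(a <- r) c a * cint i (F a) v.
Proof.
move=> nF; apply/funext => v.
have iF a : P.-integrable [set: measurableTypeR R] (EFin \o (fun t => c a * F a (upd v i t))).
  have := integrableZl measurableT (c a) (nice_int v i (nF a)).
  by apply: eq_integrable => // t _; rewrite /= EFinM.
transitivity (fine (\sum_(a <- r) \int[P]_t (c a * F a (upd v i t))%:E)%E).
  rewrite -integral_sum//; congr fine.
  by apply: eq_integral => t _; rewrite -sumEFin.
elim: r => [|a r IH]; first by rewrite !big_nil.
rewrite !big_cons -IH -RintegralZl//; last exact: nice_int.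
have fa b : (\int[P]_t (c b * F b (upd v i t))%:E)%E \is a fin_num.
  exact: (integrable_fin_num measurableT (iF b)).
by rewrite fineD//; rewrite sum_fin_num; rewrite all_map (eq_all (a2 := predT)) ?all_predT.
Qed.

Definition indep f i := forall v t, f (upd v i t) = f v.

Lemma cint_indep_mul i f g : nice g -> indep f i ->
  cint i (fun v => f v * g v) = fun v => f v * cint i g v.
Proof.
move=> ng fi; apply/funext => v; rewrite /cint.
under eq_Rintegral do rewrite fi.
by rewrite RintegralZl//; exact: nice_int.
Qed.

Lemma nice1 : nice (fun=> 1).
Proof. by split=> [v|*]; [rewrite ler01 lexx|exact: measurable_cst]. Qed.

Lemma nice_mul f g : nice f -> nice g -> nice (fun v => f v * g v).
Proof.
move=> [f1 mf] [g1 mg]; split=> [v|d T x mx]; last first.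
  by apply: measurable_funM; [exact: mf|exact: mg].
have /andP[? ?] := f1 v; have /andP[? ?] := g1 v.
by rewrite mulr_ge0//= mulr_ile1.
Qed.

Lemma nice_prod (I : Type) (r : seq I) (Q : pred I) (F : I -> (nat -> R) -> R) :
  (forall a, nice (F a)) -> nice (fun v => \prod_(a <- r | Q a) F a v).
Proof.
move=> nF; elim: r => [|a r IH].
  by under eq_fun do rewrite big_nil; exact: nice1.
under eq_fun do rewrite big_cons; case: (Q a) => //; exact: nice_mul.
Qed.

Lemma cint_indep i f : indep f i -> cint i f = f.
Proof.
move=> fi; apply/funext => v; rewrite /cint.
under eq_Rintegral do rewrite fi.
rewrite Rintegral_cst//; have /= -> := @probability_setT _ _ _ P.
by rewrite mulr1.
Qed.

Lemma indep_cint i j f : indep f i -> indep (cint j f) i.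
Proof.
move=> fi v t; rewrite /cint; apply: eq_Rintegral => s _.
case: (eqVneq i j) => [->|ij].
  by congr f; apply/funext => k; rewrite /upd; case: (k == j).
by rewrite updC// fi.
Qed.

Definition mint (s : seq nat) f := foldr cint f s.

Lemma mint_cat s1 s2 f : mint (s1 ++ s2) f = mint s1 (mint s2 f).
Proof. exact: foldr_cat. Qed.

Lemma nice_mint s f : nice f -> nice (mint s f).
Proof. by move=> nf; elim: s => //= i s; exact: nice_cint. Qed.

Lemma indep_mint s f i : indep f i -> indep (mint s f) i.
Proof. by move=> fi; elim: s => //= j s; exact: indep_cint. Qed.

Lemma mint_cons_rem s f i : nice f -> i \in s -> mint s f = mint (i :: rem i s) f.
Proof.
move=> nf; elim: s => //= j s IH; rewrite inE; case: (eqVneq j i) => [->//|ji /=].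
move=> /IH -> /=.
by rewrite cintC//; exact: nice_mint.
Qed.

Lemma mint_perm s1 s2 f : nice f -> perm_eq s1 s2 -> mint s1 f = mint s2 f.
Proof.
move=> nf; elim: s1 s2 => [|i s1 IH] s2 p12.
  by rewrite perm_sym in p12; rewrite (perm_nilP p12).
have is2 : i \in s2 by rewrite -(perm_mem p12) mem_head.
rewrite (mint_cons_rem nf is2) /= (IH (rem i s2))//.
by rewrite -(perm_cons i) (perm_trans p12)// perm_to_rem.
Qed.

Lemma mint_indep s f : (forall i, i \in s -> indep f i) -> mint s f = f.
Proof.
elim: s => //= i s IH fs.
rewrite IH => [|j js]; first by apply/cint_indep/fs; exact: mem_head.
by apply: fs; rewrite inE js orbT.
Qed.

Lemma mint_indep_mul s f g : nice g -> (forall i, i \in s -> indep f i) ->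
  mint s (fun v => f v * g v) = fun v => f v * mint s g v.
Proof.
move=> ng; elim: s => //= i s IH fs.
rewrite IH => [|j js]; last by apply: fs; rewrite inE js orbT.
rewrite cint_indep_mul//; first exact: nice_mint.
by apply: fs; exact: mem_head.
Qed.

Lemma mint_sum s (I : Type) (r : seq I) (c : I -> R) (F : I -> (nat -> R) -> R) :
  (forall a, nice (F a)) ->
  mint s (fun v => \sum_(a <- r) c a * F a v) =
  fun v => \sum_(a <- r) c a * mint s (F a) v.
Proof.
move=> nF; elim: s => //= i s ->; rewrite cint_sum// => a; exact: nice_mint.
Qed.

Lemma mint_ge0 s f v : (forall w, 0 <= f w) -> 0 <= mint s f v.
Proof.
move=> f0; elim: s v => //= i s IH v.
by apply: Rintegral_ge0 => t _; exact: IH.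
Qed.

Definition agree (l : seq (nat * nat)) v w := all (fun p => v p.1 == w p.2) l.

(** Renaming of integration variables. [l] pairs the coordinates still to be integrated, [l'] those
    already set to equal values; each integral moves one pair from [l] to [l'], and distinctness of
    the names keeps an update from spoiling earlier pairs. *)
Lemma mint_agree (l l' : seq (nat * nat)) f g :
  uniq (unzip1 (l ++ l')) -> uniq (unzip2 (l ++ l')) ->
  (forall v w, agree (l ++ l') v w -> f v = g w) ->
  forall v w, agree l' v w -> mint (unzip1 l) f v = mint (unzip2 l) g w.
Proof.
elim: l l' => [|[i j] l IH] l' /=; first by move=> _ _ fg v w; exact: fg.
move=> /andP[il u1] /andP[jl u2] fg v w vw; apply: eq_Rintegral => t _.
apply: (IH ((i, j) :: l')).
- by rewrite (perm_uniq (perm_map fst (permEl (perm_catCA l [:: (i, j)] l')))) /= il u1.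
- by rewrite (perm_uniq (perm_map snd (permEl (perm_catCA l [:: (i, j)] l')))) /= jl u2.
- move=> v' w' h; apply: fg; move: h; rewrite /agree !all_cat/= => /and3P[-> -> ->].
  by [].
- rewrite /agree /= !upd_id eqxx/=; apply/allP => -[a b] abl /=.
  rewrite !upd_neq; first exact: (allP vw (a, b)).
  + apply: contraNneq jl => <-; have := map_f snd abl.
    by rewrite /unzip2 map_cat mem_cat => ->; rewrite orbT.
  + apply: contraNneq il => <-; have := map_f fst abl.
    by rewrite /unzip1 map_cat mem_cat => ->; rewrite orbT.
Qed.

End Coordinates.

(** * Homomorphism densities *)

Lemma adj_sym (G : graph) (i j : 'I_(gsize G)) : adj G i j = adj G j i.
Proof. by rewrite /adj eq_sym orbC. Qed.

Lemma adj_neq (G : graph) (i j : 'I_(gsize G)) : adj G i j -> i != j.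
Proof. by case/andP. Qed.

(** The fourth clause states single-valuedness in both directions at once, a form stable under
    inversion and composition of relations. *)
Definition graph_iso (G H : graph) (P : {set 'I_(gsize G) * 'I_(gsize H)}) :=
  [/\ forall p, p \in P -> nonisolated G p.1 && nonisolated H p.2,
      forall i, nonisolated G i -> exists j, (i, j) \in P,
      forall j, nonisolated H j -> exists i, (i, j) \in P,
      forall p q, p \in P -> q \in P -> (p.1 == q.1) = (p.2 == q.2) &
      forall p q, p \in P -> q \in P -> adj G p.1 q.1 = adj H p.2 q.2].

(** The comprehensions inside [gequiv] are parsed as classical sets; this turns their cardinality
    into that of a finite set, to which [cards1P] applies. *)
Lemma card_mkset (T : finType) (p : pred T) :
  #|[set x | p x]%classic| = #|[set x | p x]%SET|.
Proof.
apply: eq_card => x; rewrite [RHS]inE.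
by apply/idP/idP => [/set_mem|px]; last exact: mem_set.
Qed.

Lemma gequivP (G H : graph) : gequiv G H <-> exists P, graph_iso (G := G) (H := H) P.
Proof.
split=> [/existsP[P /and4P[PP PG PH PA]]|[P [PP PG PH PF PA]]]; [exists P|apply/existsP; exists P].
- have {}PP p : p \in P -> nonisolated G p.1 && nonisolated H p.2.
    by move/forallP: PP => /(_ p) /implyP.
  have {}PG i : nonisolated G i -> exists j, [set j | (i, j) \in P]%SET = [set j]%SET.
    by move/forallP: PG => /(_ i) /implyP PG /PG; rewrite card_mkset => /cards1P.
  have {}PH j : nonisolated H j -> exists i, [set i | (i, j) \in P]%SET = [set i]%SET.
    by move/forallP: PH => /(_ j) /implyP PH /PH; rewrite card_mkset => /cards1P.
  split=> //.
  + by move=> i /PG[j /setP/(_ j)]; rewrite !inE eqxx; exists j.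
  + by move=> j /PH[i /setP/(_ i)]; rewrite !inE eqxx; exists i.
  + move=> [i j] [i' j'] /= Pp Pq; apply/eqP/eqP => ?; subst.
      have /andP[/PG[k /setP kP] _] := PP _ Pp.
      by have := kP j; have := kP j'; rewrite !inE Pp Pq => /esym/eqP -> /esym/eqP.
    have /andP[_ /PH[k /setP kP]] := PP _ Pp.
    by have := kP i; have := kP i'; rewrite !inE Pp Pq => /esym/eqP -> /esym/eqP.
  + move=> p q Pp Pq; move/forallP: PA => /(_ p) /implyP/(_ Pp).
    by move=> /forallP/(_ q) /implyP/(_ Pq) /eqP.
- apply/and4P; split.
  + by apply/forallP => p; apply/implyP/PP.
  + apply/forallP => i; apply/implyP => /PG[j Pij]; rewrite card_mkset; apply/cards1P; exists j.
    apply/setP => k; rewrite !inE; apply/idP/eqP => [Pik|->//].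
    by apply/eqP; rewrite -(PF (i, k) (i, j)).
  + apply/forallP => j; apply/implyP => /PH[i Pij]; rewrite card_mkset; apply/cards1P; exists i.
    apply/setP => k; rewrite !inE; apply/idP/eqP => [Pkj|->//].
    by apply/eqP; rewrite (PF (k, j) (i, j)).
  + apply/forallP => p; apply/implyP => Pp; apply/forallP => q; apply/implyP => Pq.
    by apply/eqP/PA.
Qed.

(** An embedding of all nodes is easier to supply than a relation between non-isolated ones; its
    image may miss isolated nodes of [H]. *)
Lemma gequiv_inj (G H : graph) (f : 'I_(gsize G) -> 'I_(gsize H)) :
  injective f -> (forall i j, adj H (f i) (f j) = adj G i j) ->
  (forall j, nonisolated H j -> exists i, j = f i) -> gequiv G H.
Proof.
move=> fI fA fS; apply/gequivP.
exists [set p | nonisolated G p.1 && (p.2 == f p.1)]%SET.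
have fN i : nonisolated H (f i) -> nonisolated G i.
  move=> /existsP[j aij]; have [|k jk] := fS j.
    by apply/existsP; exists (f i); rewrite adj_sym.
  by apply/existsP; exists k; rewrite -fA -jk.
split.
- move=> [i j]; rewrite inE/= => /andP[Ni /eqP ->]; rewrite Ni/=.
  by case/existsP: Ni => k ik; apply/existsP; exists (f k); rewrite fA.
- by move=> i Ni; exists (f i); rewrite inE/= Ni eqxx.
- by move=> j Nj; have [i ji] := fS j Nj; exists i; rewrite inE/= ji eqxx fN// -ji.
- move=> [i j] [i' j']; rewrite !inE/= => /andP[_ /eqP ->] /andP[_ /eqP ->].
  by rewrite (inj_eq fI).
- by move=> [i j] [i' j']; rewrite !inE/= => /andP[_ /eqP ->] /andP[_ /eqP ->].
Qed.

Lemma gequiv_refl G : gequiv G G.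
Proof. by apply: (@gequiv_inj _ _ id) => // j _; exists j. Qed.

Lemma gequiv_sym G H : gequiv G H = gequiv H G.
Proof.
suff imp A B : gequiv A B -> gequiv B A by apply/idP/idP; exact: imp.
move=> /gequivP[P [PP PG PH PF PA]]; apply/gequivP.
exists [set p | (p.2, p.1) \in P]%SET; split.
- by move=> p; rewrite inE => /PP; rewrite andbC.
- by move=> i /PH[j Pij]; exists j; rewrite inE.
- by move=> i /PG[j Pij]; exists j; rewrite inE.
- by move=> p q; rewrite !inE => Pp Pq; rewrite (PF _ _ Pp Pq).
- by move=> p q; rewrite !inE => Pp Pq; rewrite (PA _ _ Pp Pq).
Qed.

Lemma gequiv_trans G H K : gequiv G H -> gequiv H K -> gequiv G K.
Proof.
move=> /gequivP[P [PP PG PH PF PA]] /gequivP[Q [QQ QG QH QF QA]]; apply/gequivP.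
exists [set p | [exists j, ((p.1, j) \in P) && ((j, p.2) \in Q)]]%SET; split.
- move=> p; rewrite inE => /existsP[j /andP[/PP/andP[/= -> _] /QQ/andP[_ /= ->]]].
  by [].
- move=> i /PG[j Pij]; have /andP[_ /QG[k Qjk]] := PP _ Pij.
  by exists k; rewrite inE; apply/existsP; exists j; rewrite Pij.
- move=> i /QH[j Pij]; have /andP[/PH[k Qjk] _] := QQ _ Pij.
  by exists k; rewrite inE; apply/existsP; exists j; rewrite Qjk.
- move=> p q; rewrite !inE => /existsP[j /andP[P1 Q1]] /existsP[j' /andP[P2 Q2]].
  by have /= -> := PF _ _ P1 P2; have /= -> := QF _ _ Q1 Q2.
- move=> p q; rewrite !inE => /existsP[j /andP[P1 Q1]] /existsP[j' /andP[P2 Q2]].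
  by have /= -> := PA _ _ P1 P2; have /= -> := QA _ _ Q1 Q2.
Qed.

Lemma gequiv_eq G H F : gequiv G H -> gequiv G F = gequiv H F.
Proof.
move=> GH; apply/idP/idP; apply: gequiv_trans => //; by rewrite gequiv_sym.
Qed.

Section Density.
Context {R : realType}.
Implicit Types (W : R * R -> R) (v w : nat -> R).

(** A probability on the whole line, so that no integral below has to carry the domain [0,1]. *)
Definition unif : probability (measurableTypeR R) R := uniform_prob (@ltr01 R).

Lemma mint_upd (P : probability (measurableTypeR R) R) s f n t v : n \notin s ->
  mint P s (fun v => f (upd v n t)) v = mint P s f (upd v n t).
Proof.
elim: s v => //= i s IH v; rewrite inE negb_or => /andP[ni ns].
by apply: eq_Rintegral => u _; rewrite IH// updC// eq_sym.
Qed.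

(** [iint] integrates the last coordinate outermost, hence the reversed list; the base point 0 is
    the value at which [iint] bottoms out. *)
Lemma iint_mint n f : nice f ->
  iint n (fun v => (f v)%:E) = (mint unif (rev (iota 0 n)) f (fun=> 0))%:E.
Proof.
elim: n f => //= n IH f nf.
have nt t : nice (fun v => f (upd v n t)).
  split=> [v|d T x mx]; first exact: nf.1.
  apply: (nf.2 _ _ (fun s => upd (x s) n t)) => i; rewrite /upd.
  by case: (i == n) => //; exact: measurable_cst.
under eq_integral do rewrite (IH _ (nt _)).
have -> : rev (0%N :: iota 1 n) = n :: rev (iota 0 n).
  by rewrite -[0%N :: _]/(iota 0 n.+1) -addn1 iotaD rev_cat.
rewrite /= cint_EFin; last exact: nice_mint.
rewrite integral_uniform; last 2 first.
- apply/measurable_EFinP; move: (nice_upd (fun=> 0) n (nice_mint unif (rev (iota 0 n)) nf)); exact.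
- by move=> t; rewrite lee_fin; case/andP: ((nice_mint unif (rev (iota 0 n)) nf).1 (upd (fun=> 0) n t)).
rewrite subr0 invr1 mul1e; apply: eq_integral => t _; congr EFin.
by rewrite mint_upd// mem_rev mem_iota add0n ltnn andbF.
Qed.

Lemma nice_graphon W i j : graphon W -> nice (fun v => W (v i, v j)).
Proof.
move=> [mW _ W1]; split=> // d T x mx.
exact: (measurableT_comp mW (measurable_fun_pair (mx i) (mx j))).
Qed.

Definition edge_prod (G : graph) W (h : 'I_(gsize G) -> nat) v : R :=
  \prod_(i : 'I_(gsize G)) \prod_(j : 'I_(gsize G) | (i < j)%N && adj G i j)
     W (v (h i), v (h j)).

Lemma nice_edge_prod G W (h : 'I_(gsize G) -> nat) : graphon W ->
  nice (edge_prod W h).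
Proof. by move=> gW; do 2![apply: nice_prod => ?]; exact: nice_graphon. Qed.

(** Frees the density from the layout fixed by [iint]: nodes may sit at any distinct coordinates.
    Since every coordinate read by the integrand is integrated, [mint_agree] applies with empty [l']
    and the base point is arbitrary. *)
Lemma hom_density_place G W (h : 'I_(gsize G) -> nat) v : graphon W ->
  injective h ->
  hom_density G W = mint unif [seq h i | i <- enum 'I_(gsize G)] (edge_prod W h) v.
Proof.
move=> gW hI; rewrite /hom_density.
have ne := nice_edge_prod (G := G) val gW.
rewrite (iint_mint (gsize G) ne) /=.
have pr : perm_eq (rev (iota 0 (gsize G))) [seq val i | i <- enum 'I_(gsize G)].
  by rewrite val_enum_ord perm_rev.
rewrite (mint_perm _ ne pr).
pose l := [seq (val i, h i) | i <- enum 'I_(gsize G)].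
have <- : unzip1 l = [seq val i | i <- enum 'I_(gsize G)] by rewrite /unzip1 -map_comp.
have <- : unzip2 l = [seq h i | i <- enum 'I_(gsize G)] by rewrite /unzip2 -map_comp.
apply: (@mint_agree _ _ l [::]) => //.
- by rewrite cats0 /unzip1 -map_comp map_inj_uniq ?enum_uniq//; exact: val_inj.
- by rewrite cats0 /unzip2 -map_comp map_inj_uniq ?enum_uniq.
move=> v' w' /allP vw; apply: eq_bigr => i _; apply: eq_bigr => j _.
have e k : v' (val k) = w' (h k).
  apply/eqP; apply: (vw (val k, h k)); rewrite cats0.
  by apply/mapP; exists k; rewrite ?mem_enum.
by rewrite !e.
Qed.

Lemma edge_prod_ge0 G W (h : 'I_(gsize G) -> nat) v : graphon W ->
  0 <= edge_prod W h v.
Proof. by move=> gW; case/andP: ((nice_edge_prod h gW).1 v). Qed.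

Lemma hom_density_ge0_le1 G W : graphon W -> 0 <= hom_density G W <= 1.
Proof.
move=> gW; rewrite (hom_density_place (h := val) (fun=> 0) gW val_inj).
exact: (nice_mint _ _ (nice_edge_prod _ gW)).1.
Qed.

Lemma edge_prod_sqr G W (h : 'I_(gsize G) -> nat) v : graphon W ->
  edge_prod W h v ^+ 2 =
  \prod_(i : 'I_(gsize G)) \prod_(j : 'I_(gsize G) | adj G i j) W (v (h i), v (h j)).
Proof.
move=> [_ Ws _].
transitivity (edge_prod W h v *
  \prod_(i : 'I_(gsize G)) \prod_(j : 'I_(gsize G) | (j < i)%N && adj G i j)
     W (v (h i), v (h j))).
  rewrite expr2; congr (_ * _); rewrite /edge_prod (exchange_big_dep predT)//=.
  apply: eq_bigr => i _; apply: eq_big => [j|j _]; first by rewrite adj_sym.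
  exact: Ws.
rewrite -big_split; apply: eq_bigr => i _ /=.
rewrite [RHS](bigID (fun j : 'I_ _ => (i < j)%N)) /=; congr (_ * _).
  by apply: eq_bigl => j; rewrite andbC.
apply: eq_bigl => j; case: (boolP (adj G i j)) => [/adj_neq ij|]; rewrite ?andbF//.
have ji : (j : nat) != i by apply: contraNneq ij => /val_inj ->.
by rewrite andbT -leqNgt ltn_neqAle ji.
Qed.

(* The square of the edge product runs over ordered pairs of adjacent nodes,
   so it can be reindexed without keeping track of the order of the nodes. *)
Lemma edge_prod_gequiv G H W (hG : 'I_(gsize G) -> nat) (hH : 'I_(gsize H) -> nat)
    (P : {set 'I_(gsize G) * 'I_(gsize H)}) v w : graphon W ->
  graph_iso P -> (forall p, p \in P -> v (hG p.1) = w (hH p.2)) ->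
  edge_prod W hG v = edge_prod W hH w.
Proof.
move=> gW [PP PG PH PF PA] vw.
apply: (@pexpIrn _ 2) => //; rewrite ?nnegrE ?edge_prod_ge0//.
rewrite !edge_prod_sqr//.
(* Isolated nodes contribute 1, and [P] projects bijectively onto the non-isolated nodes of either
   graph, so both sides become products over [P]. *)
have red1 (F : 'I_(gsize G) -> R) : (forall i, ~~ nonisolated G i -> F i = 1) ->
    \prod_i F i = \prod_(p in P) F p.1.
  move=> F1; rewrite (bigID (nonisolated G)) /= [X in _ * X]big1// mulr1.
  rewrite -(big_imset (h := fst) F); last first.
    by move=> [a b] [c d] Pp Pq /= e; have := PF _ _ Pp Pq; rewrite /= e eqxx => /esym/eqP ->.
  apply: eq_bigl => i; apply/idP/imsetP => [/PG[j Pij]|[p /PP/andP[+ _] ->]//].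
  by exists (i, j).
have red2 (F : 'I_(gsize H) -> R) : (forall i, ~~ nonisolated H i -> F i = 1) ->
    \prod_i F i = \prod_(p in P) F p.2.
  move=> F1; rewrite (bigID (nonisolated H)) /= [X in _ * X]big1// mulr1.
  rewrite -(big_imset (h := snd) F); last first.
    by move=> [a b] [c d] Pp Pq /= e; have := PF _ _ Pp Pq; rewrite /= e eqxx => /eqP ->.
  apply: eq_bigl => i; apply/idP/imsetP => [/PH[j Pij]|[p /PP/andP[_ +] ->]//].
  by exists (j, i).
rewrite red1; last first.
  move=> i /existsPn Ni; apply: big1 => j ij; by rewrite (negbTE (Ni j)) in ij.
rewrite red2; last first.
  move=> i /existsPn Ni; apply: big1 => j ij; by rewrite (negbTE (Ni j)) in ij.
apply: eq_bigr => p Pp; rewrite big_mkcond [RHS]big_mkcond red1; last first.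
  move=> j Nj; case: ifP => // pj; case/negP: Nj.
  by apply/existsP; exists p.1; rewrite adj_sym.
rewrite red2; last first.
  move=> j Nj; case: ifP => // pj; case/negP: Nj.
  by apply/existsP; exists p.2; rewrite adj_sym.
by apply: eq_bigr => q Pq; rewrite PA// !vw.
Qed.

Lemma edge_prod_indep G W (h : 'I_(gsize G) -> nat) k :
  (forall i, h i = k -> ~~ nonisolated G i) -> indep (edge_prod W h) k.
Proof.
move=> hk v t; apply: eq_bigr => i _; apply: eq_bigr => j /andP[_ ij].
rewrite !upd_neq//; apply/eqP => /hk /existsPn Nk.
- by have := Nk i; rewrite adj_sym ij.
- by have := Nk j; rewrite ij.
Qed.

Lemma hom_density_noniso G W v : graphon W ->
  hom_density G W =
  mint unif [seq val i | i <- enum (nonisolated G)] (edge_prod (G := G) W val) v.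
Proof.
move=> gW; rewrite (hom_density_place (h := val) v gW val_inj).
have ne := nice_edge_prod (G := G) val gW.
have -> : mint unif [seq val i | i <- enum 'I_(gsize G)] (edge_prod (G := G) W val) =
    mint unif ([seq val i | i <- enum (nonisolated G)] ++
               [seq val i | i <- enum (predC (nonisolated G))]) (edge_prod (G := G) W val).
  apply: mint_perm => //; rewrite -map_cat perm_map//.
  apply: uniq_perm => [||i]; first exact: enum_uniq.
    rewrite cat_uniq !enum_uniq andbT; apply/hasPn => i.
    by rewrite !mem_enum.
  by rewrite mem_cat !mem_enum orbN.
rewrite mint_cat [X in mint _ _ X]mint_indep// => _ /mapP[i + ->].
rewrite mem_enum => Ni; apply: edge_prod_indep => j /val_inj ->; exact: Ni.
Qed.

(** Once isolated nodes are integrated out, the pairs of [P] themselves form a renaming list for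
    [mint_agree]. *)
Lemma hom_density_gequiv G H W : graphon W -> gequiv G H ->
  hom_density G W = hom_density H W.
Proof.
move=> gW /gequivP[P iP]; have [PP PG PH PF PA] := iP.
rewrite (hom_density_noniso G (fun=> 0) gW) (hom_density_noniso H (fun=> 0) gW).
pose l := [seq (val p.1, val p.2) | p <- enum P].
have u1 : uniq (unzip1 l).
  rewrite /unzip1 -map_comp map_inj_in_uniq ?enum_uniq// => -[a b] [c d].
  rewrite !mem_enum => Pp Pq /= /val_inj e; have := PF _ _ Pp Pq.
  by rewrite /= e eqxx => /esym/eqP ->.
have u2 : uniq (unzip2 l).
  rewrite /unzip2 -map_comp map_inj_in_uniq ?enum_uniq// => -[a b] [c d].
  rewrite !mem_enum => Pp Pq /= /val_inj e; have := PF _ _ Pp Pq.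
  by rewrite /= e eqxx => /eqP ->.
have <- : mint unif (unzip1 l) (edge_prod (G := G) W val) =
    mint unif [seq val i | i <- enum (nonisolated G)] (edge_prod (G := G) W val).
  apply: mint_perm; first exact: nice_edge_prod.
  apply: uniq_perm => //; first by rewrite map_inj_uniq ?enum_uniq//; exact: val_inj.
  move=> k; rewrite /unzip1 -map_comp; apply/mapP/mapP => -[].
    by move=> p; rewrite mem_enum => /PP/andP[Np _] ->; exists p.1; rewrite ?mem_enum.
  move=> i; rewrite mem_enum => /PG[j Pij] ->.
  by exists (i, j); rewrite ?mem_enum.
have <- : mint unif (unzip2 l) (edge_prod (G := H) W val) =
    mint unif [seq val i | i <- enum (nonisolated H)] (edge_prod (G := H) W val).
  apply: mint_perm; first exact: nice_edge_prod.
  apply: uniq_perm => //; first by rewrite map_inj_uniq ?enum_uniq//; exact: val_inj.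
  move=> k; rewrite /unzip2 -map_comp; apply/mapP/mapP => -[].
    by move=> p; rewrite mem_enum => /PP/andP[_ Np] ->; exists p.2; rewrite ?mem_enum.
  move=> i; rewrite mem_enum => /PH[j Pij] ->.
  by exists (j, i); rewrite ?mem_enum.
apply: (@mint_agree _ _ l [::]) => //; rewrite ?cats0// => v w /allP vw.
apply: (edge_prod_gequiv gW iP) => p Pp; apply/eqP.
by apply: (vw (val p.1, val p.2)); apply/mapP; exists p; rewrite ?mem_enum.
Qed.

End Density.

(** * The l1 norm *)

Section Norm.
Context {R : realType}.
Implicit Types (z : qgraph R) (F : graph).

Definition term_at z i := nth (0, @Graph 0 finset.set0) z i.

Definition first_occ z (i : 'I_(size z)) :=
  [forall j : 'I_(size z), (j < i)%N ==> ~~ gequiv (term_at z j).2 (term_at z i).2].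

Lemma qnorm1E z : qnorm1 z = \sum_(i | @first_occ z i) `|qcoef z (term_at z i).2|.
Proof. by []. Qed.

Lemma first_occ_uniq z F i j : @first_occ z i -> @first_occ z j ->
  gequiv (term_at z i).2 F -> gequiv (term_at z j).2 F -> i = j.
Proof.
have lt (a b : 'I_(size z)) : @first_occ z b -> gequiv (term_at z a).2 F ->
    gequiv (term_at z b).2 F -> ~~ (a < b)%N.
  move=> /forallP/(_ a)/implyP fb aF bF; apply/negP => /fb.
  by rewrite (gequiv_eq _ aF) gequiv_sym bF.
move=> fi fj iF jF; case: (ltngtP i j) => [ij|ji|/ord_inj//].
  by have := lt i j fj iF jF; rewrite ij.
by have := lt j i fi jF iF; rewrite ji.
Qed.

Lemma first_occ_exists z F (i : 'I_(size z)) : gequiv (term_at z i).2 F ->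
  exists2 r, @first_occ z r & gequiv (term_at z r).2 F.
Proof.
move=> iF.
case: (arg_minnP (P := fun j : 'I_(size z) => gequiv (term_at z j).2 F) (fun j => val j) iF).
move=> r rF rmin; exists r => //; apply/forallP => j; apply/implyP => jr.
apply/negP => gjr; have := rmin j (gequiv_trans gjr rF).
by rewrite leqNgt jr.
Qed.

Lemma big_term z (f : R * graph -> R) :
  \sum_(p <- z) f p = \sum_(i < size z) f (term_at z i).
Proof. by rewrite (big_nth (0, @Graph 0 finset.set0)) big_mkord. Qed.

(** Equivalent graphs have equal densities, so terms can be collected at the first occurrence of
    their class; each class coefficient is then multiplied by a number in [0,1]. *)
Lemma normr_qeval_le z W : graphon W -> `|qeval z W| <= qnorm1 z.
Proof.
move=> gW; have -> : qeval z W =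
    \sum_(r | @first_occ z r) qcoef z (term_at z r).2 * hom_density (term_at z r).2 W.
  rewrite /qeval big_term.
  transitivity (\sum_(i < size z) \sum_(r | @first_occ z r && gequiv (term_at z i).2 (term_at z r).2)
      (term_at z i).1 * hom_density (term_at z r).2 W).
    apply: eq_bigr => i _.
    have [r fr ri] := @first_occ_exists z _ i (gequiv_refl _).
    rewrite (big_pred1 r) => [|s]; first by rewrite (hom_density_gequiv gW ri).
    apply/andP/eqP => [[fs si]|->]; last by rewrite gequiv_sym.
    by apply: (first_occ_uniq fs fr _ ri); rewrite gequiv_sym.
  rewrite (exchange_big_dep (@first_occ z))/= => [|i r _ /andP[]//].
  apply: eq_bigr => r fr; rewrite /qcoef [X in _ = X * _]big_mkcond big_term mulr_suml.
  rewrite big_mkcond; apply: eq_bigr => i _; rewrite fr /=.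
  by case: ifP => // _; rewrite mul0r.
rewrite qnorm1E; apply: le_trans (ler_norm_sum _ _ _) _.
apply: ler_sum => r _; rewrite normrM ler_piMr//.
by have /andP[h0 h1] := hom_density_ge0_le1 (term_at z r).2 gW; rewrite ger0_norm.
Qed.

(** Any list with the same coefficients bounds the norm, so cancellations can be carried out in [z']
    beforehand. The bound holds because each term of [z'] is charged to at most one class
    representative in [z]. *)
Lemma qnorm1_le z z' : (forall F, qcoef z F = qcoef z' F) ->
  qnorm1 z <= \sum_(p <- z') `|p.1|.
Proof.
move=> zz'; rewrite qnorm1E.
apply: (@le_trans _ _ (\sum_(r | @first_occ z r)
    \sum_(p <- z' | gequiv p.2 (term_at z r).2) `|p.1|)).
  by apply: ler_sum => r _; rewrite zz' ler_norm_sum.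
rewrite (exchange_big_dep predT)//=; apply: ler_sum => p _.
case: (pickP (fun r => @first_occ z r && gequiv p.2 (term_at z r).2)) => [r|no].
  move=> /andP[fr pr]; rewrite (big_pred1 r)// => s; apply/andP/eqP => [[fs ps]|->//].
  by apply: (first_occ_uniq (F := p.2)) => //; rewrite gequiv_sym.
by rewrite big_pred0// normr_ge0.
Qed.

End Norm.

(** * Products of labeled graphs *)

(** Comparing nodes by their values makes the transport along associativity in [lmul] disappear. *)
Lemma in_ecast_set (m n : nat) (e : m = n) (E : {set 'I_m * 'I_m}) (i j : 'I_n) :
  ((i, j) \in ecast n ({set 'I_n * 'I_n}) e E) =
  [exists p in E, (val p.1 == val i) && (val p.2 == val j)].
Proof.
case: _ / e i j => i j; apply/idP/existsP => [ijE|[[a b] /andP[abE /andP[/= ai bj]]]].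
  by exists (i, j); rewrite ijE !eqxx.
by rewrite -(ord_inj (eqP ai)) -(ord_inj (eqP bj)).
Qed.

(** The effect of [emb2] on values: labels stay, unlabeled nodes of the second factor jump over the
    [a] unlabeled nodes of the first. *)
Definition lsh (k a x : nat) := if (x < k)%N then x else (x + a)%N.

Lemma val_emb2 k m1 m2 (i : 'I_(k + m2)) : val (emb2 m1 i) = lsh k m1 i.
Proof.
rewrite /emb2 /lsh; case: splitP => j ij /=; rewrite [\val i]ij //.
by rewrite addnAC.
Qed.

Lemma in_lmul k (A B : lgraph k) (i j : 'I_(k + (lfree A + lfree B))) :
  ((i, j) \in ledges (lmul A B)) =
  [exists p in ledges A, (val p.1 == val i) && (val p.2 == val j)] ||
  [exists p in ledges B, (lsh k (lfree A) p.1 == i) && (lsh k (lfree A) p.2 == j)].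
Proof.
rewrite in_ecast_set; apply/existsP/orP.
  move=> [p /andP[/setUP[/imsetP[q qE ->]|/imsetP[q qE ->]] /= pq]].
    by left; apply/existsP; exists q; rewrite qE.
  by right; apply/existsP; exists q; rewrite qE -!val_emb2.
move=> [|] /existsP[q /andP[qE q12]].
  exists (emb1 (lfree B) q.1, emb1 (lfree B) q.2); rewrite q12 andbT.
  by apply/setUP; left; apply/imsetP; exists q.
exists (emb2 (lfree A) q.1, emb2 (lfree A) q.2); rewrite /= !val_emb2 q12 andbT.
by apply/setUP; right; apply/imsetP; exists q.
Qed.

Lemma exists_val_pair (n : nat) (E : {set 'I_n * 'I_n}) (f : nat -> nat) (x y : nat)
    (i j : 'I_n) : injective f -> f i = x -> f j = y ->
  [exists p in E, (f (val p.1) == x) && (f (val p.2) == y)] = ((i, j) \in E).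
Proof.
move=> fI <- <-; apply/existsP/idP => [[[a b] /andP[abE /andP[/= ai bj]]]|ijE].
  by rewrite -(ord_inj (fI _ _ (eqP ai))) -(ord_inj (fI _ _ (eqP bj))).
by exists (i, j); rewrite ijE !eqxx.
Qed.

Lemma exists_val_pairF (n : nat) (E : {set 'I_n * 'I_n}) (f : nat -> nat) (x y : nat) :
  (forall i : 'I_n, f i != x) \/ (forall i : 'I_n, f i != y) ->
  [exists p in E, (f (val p.1) == x) && (f (val p.2) == y)] = false.
Proof.
move=> xy; apply/existsP => -[p /and3P[_ px py]].
by case: xy => [/(_ p.1)|/(_ p.2)]; rewrite ?px ?py.
Qed.

Lemma lsh_inj k a : injective (lsh k a).
Proof. by move=> x y /=; rewrite /lsh; do 2![case: ltnP => ?]; lia. Qed.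

Section Product.
Variables (k : nat) (A B : lgraph k).
Let a := lfree A.
Let b := lfree B.
Let M := unlabel (lmul A B).
Let eL (i : 'I_k) : 'I_(k + (a + b)) := lshift (a + b) i.
Let eA (i : 'I_a) : 'I_(k + (a + b)) := rshift k (lshift b i).
Let eB (i : 'I_b) : 'I_(k + (a + b)) := rshift k (rshift a i).

Lemma lmul_edge1 (i j : 'I_(k + a)) (x y : 'I_(k + (a + b))) :
  val x = val i -> val y = val j ->
  [exists p in ledges A, (val p.1 == val x) && (val p.2 == val y)] = ((i, j) \in ledges A).
Proof.
by move=> xi yj; apply: (exists_val_pair _ (f := id)) => //; exact: inj_id.
Qed.

Lemma lmul_edge2 (i j : 'I_(k + b)) (x y : 'I_(k + (a + b))) :
  lsh k a i = x -> lsh k a j = y ->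
  [exists p in ledges B, (lsh k a p.1 == x) && (lsh k a p.2 == y)] =
  ((i, j) \in ledges B).
Proof. by apply: exists_val_pair; exact: lsh_inj. Qed.

Lemma lmul_edge1F (x y : 'I_(k + (a + b))) : (k + a <= x)%N \/ (k + a <= y)%N ->
  [exists p in ledges A, (val p.1 == val x) && (val p.2 == val y)] = false.
Proof.
move=> xy; apply: (exists_val_pairF _ (f := id)).
by case: xy => xy; [left|right] => i; rewrite neq_ltn (leq_trans (ltn_ord i) xy).
Qed.

Lemma lmul_edge2F (x y : 'I_(k + (a + b))) : (k <= x < k + a)%N \/ (k <= y < k + a)%N ->
  [exists p in ledges B, (lsh k a p.1 == x) && (lsh k a p.2 == y)] = false.
Proof.
move=> xy; apply: exists_val_pairF.
by case: xy => xy; [left|right] => i; rewrite /lsh; case: ltnP => ?; lia.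
Qed.

Lemma adj_lmul_LL i j : adj M (eL i) (eL j) =
  adj (unlabel A) (lshift a i) (lshift a j) || adj (unlabel B) (lshift b i) (lshift b j).
Proof.
have lL (m : 'I_k) : lsh k a (lshift b m) = eL m by rewrite /lsh /= ltn_ord.
rewrite /adj /= !in_lmul !(lmul_edge2 (lL _) (lL _)).
rewrite (@lmul_edge1 (lshift a i) (lshift a j))// (@lmul_edge1 (lshift a j) (lshift a i))//.
rewrite !(inj_eq (@lshift_inj _ _)) -andb_orr; congr (_ && _).
by rewrite orbACA.
Qed.

(** An unlabeled endpoint from the first factor rules out any edge from the second, so no merging
    takes place here; unions arise only in [adj_lmul_LL]. *)
Lemma adj_lmul_A (i j : 'I_(k + a)) (x y : 'I_(k + (a + b))) : val x = val i -> val y = val j ->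
  (k <= x < k + a)%N \/ (k <= y < k + a)%N -> adj M x y = adj (unlabel A) i j.
Proof.
move=> xi yj xy; rewrite /adj /= !in_lmul.
have -> : (x == y) = (i == j) by rewrite -!(inj_eq val_inj) xi yj.
by rewrite (lmul_edge1 xi yj) (lmul_edge1 yj xi) !lmul_edge2F ?orbF//; case: xy; auto.
Qed.

Lemma adj_lmul_B (i j : 'I_(k + b)) (x y : 'I_(k + (a + b))) : lsh k a i = x -> lsh k a j = y ->
  (k + a <= x)%N \/ (k + a <= y)%N -> adj M x y = adj (unlabel B) i j.
Proof.
move=> xi yj xy; rewrite /adj /= !in_lmul.
have -> : (x == y) = (i == j).
  by rewrite -!(inj_eq val_inj) /= -xi -yj (inj_eq (@lsh_inj _ _)).
by rewrite (lmul_edge2 xi yj) (lmul_edge2 yj xi) !lmul_edge1F//; case: xy; auto.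
Qed.

Lemma adj_lmul_AB i j : adj M (eA i) (eB j) = false.
Proof.
rewrite /adj /= !in_lmul !lmul_edge1F ?lmul_edge2F ?andbF//=.
- by right; rewrite leq_addr ltn_add2l ltn_ord.
- by left; rewrite leq_addr ltn_add2l ltn_ord.
- by left; rewrite addnA leq_addr.
- by right; rewrite addnA leq_addr.
Qed.

End Product.

(** * Nonnegativity of squares at a graphon *)

Section LabeledProducts.
Context {R : realType}.
Implicit Types (W : R * R -> R) (v w : nat -> R).

(** Labels come first, so [k <= j] for the larger endpoint says that some endpoint is unlabeled:
    these are the edges a product cannot merge. [h] places the nodes, by [id] for a first factor and
    by [lsh] for a second. *)
Definition free_prod k (A : lgraph k) W (h : nat -> nat) v : R :=
  \prod_(i : 'I_(k + lfree A))
    \prod_(j : 'I_(k + lfree A) | (k <= j)%N && ((i < j)%N && adj (unlabel A) i j))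
      W (v (h i), v (h j)).

Definition label_edges k (A : lgraph k) : {set 'I_k * 'I_k} :=
  [set e : 'I_k * 'I_k | (e.1 < e.2)%N &&
     adj (unlabel A) (lshift (lfree A) e.1) (lshift (lfree A) e.2)]%SET.

Definition label_prod k (S : {set 'I_k * 'I_k}) W v : R :=
  \prod_(e in S) W (v (val e.1), v (val e.2)).

Lemma free_prodE k (A : lgraph k) W h v : free_prod A W h v =
  (\prod_(i < k) \prod_(j < lfree A)
    if adj (unlabel A) (lshift _ i) (rshift k j) then W (v (h i), v (h (k + j)%N)) else 1) *
  (\prod_(i < lfree A) \prod_(j < lfree A)
    if (i < j)%N && adj (unlabel A) (rshift k i) (rshift k j)
    then W (v (h (k + i)%N), v (h (k + j)%N)) else 1).
Proof.
rewrite /free_prod; under eq_bigr do rewrite big_mkcond big_split_ord.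
rewrite big_split_ord /= !big_split /=.
rewrite [X in X * _ * _ = _]big1; last first.
  by move=> i _; apply: big1 => j _; rewrite leqNgt ltn_ord.
rewrite [X in _ * (X * _) = _]big1; last first.
  by move=> i _; apply: big1 => j _; rewrite leqNgt ltn_ord.
rewrite !mul1r; congr (_ * _); apply: eq_bigr => i _; apply: eq_bigr => j _.
  by rewrite leq_addr ltn_addr.
by rewrite leq_addr ltn_add2l.
Qed.

Lemma edge_prod_lmul k (A B : lgraph k) W v :
  edge_prod (G := unlabel (lmul A B)) W val v =
  label_prod (label_edges A :|: label_edges B) W v *
  (free_prod A W id v * free_prod B W (lsh k (lfree A)) v).
Proof.
have lL i : (i < k)%N -> lsh k (lfree A) i = i by rewrite /lsh => ->.
have lR i : lsh k (lfree A) (k + i) = (k + (lfree A + i))%N.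
  by rewrite /lsh ltnNge leq_addr /= addnAC addnA.
have prod3 (F : 'I_(k + (lfree A + lfree B)) -> R) : \prod_i F i =
    (\prod_i F (lshift _ i)) * ((\prod_i F (rshift k (lshift _ i))) *
     (\prod_i F (rshift k (rshift (lfree A) i)))).
  by rewrite big_split_ord /= [X in _ * X = _]big_split_ord.
rewrite /edge_prod; under eq_bigr do rewrite big_mkcond prod3.
rewrite prod3 !big_split !free_prodE /label_prod.
(* Nine blocks: labels, unlabeled nodes of A, unlabeled nodes of B. [AL] and [BL] are empty since
   pairs are increasing, [AB] and [BA] carry no edges, [LL] is the union of the label edges, and the
   other four are the two free products. *)
set LL := (X in X * _ * _ = _); set LA := (X in _ * (X * _) * _ = _).
set LB := (X in _ * (_ * X) * _ = _).
set AL := (X in _ * ((X * _) * _) = _); set AA := (X in _ * ((_ * (X * _)) * _) = _).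
set AB := (X in _ * ((_ * (_ * X)) * _) = _).
set BL := (X in _ * (_ * (X * _)) = _); set BA := (X in _ * (_ * (_ * (X * _))) = _).
set BB := (X in _ * (_ * (_ * (_ * X))) = _).
have -> : AL = 1.
  by apply: big1 => i _; apply: big1 => j _; rewrite ltnNge/= ltnW// ltn_addr.
have -> : BL = 1.
  by apply: big1 => i _; apply: big1 => j _; rewrite ltnNge/= ltnW// ltn_addr.
have -> : AB = 1.
  by apply: big1 => i _; apply: big1 => j _; rewrite adj_lmul_AB andbF.
have -> : BA = 1.
  by apply: big1 => i _; apply: big1 => j _; rewrite adj_sym adj_lmul_AB andbF.
set S := label_edges A :|: label_edges B.
have -> : LL = \prod_(e in S) W (v (val e.1), v (val e.2)).
  rewrite /LL pair_bigA [RHS]big_mkcond; apply: eq_bigr => -[i j] _ /=.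
  by rewrite !inE /= -andb_orr adj_lmul_LL.
rewrite !mul1r !mulr1 -!mulrA; congr (_ * _).
have -> : LA = \prod_(i < k) \prod_(j < lfree A)
    if adj (unlabel A) (lshift _ i) (rshift k j) then W (v i, v (k + j)%N) else 1.
  apply: eq_bigr => i _; apply: eq_bigr => j _.
  rewrite (@adj_lmul_A _ _ _ (lshift (lfree A) i) (rshift k j))//=.
    by rewrite ltn_addr.
  by right; rewrite leq_addr ltn_add2l ltn_ord.
have -> : AA = \prod_(i < lfree A) \prod_(j < lfree A)
    if (i < j)%N && adj (unlabel A) (rshift k i) (rshift k j)
    then W (v (k + i)%N, v (k + j)%N) else 1.
  apply: eq_bigr => i _; apply: eq_bigr => j _.
  rewrite (@adj_lmul_A _ _ _ (rshift k i) (rshift k j))//=; first by rewrite ltn_add2l.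
  by right; rewrite leq_addr ltn_add2l ltn_ord.
have -> : LB = \prod_(i < k) \prod_(j < lfree B)
    if adj (unlabel B) (lshift _ i) (rshift k j) then
      W (v (lsh k (lfree A) i), v (lsh k (lfree A) (k + j)%N)) else 1.
  apply: eq_bigr => i _; apply: eq_bigr => j _.
  rewrite (@adj_lmul_B _ _ _ (lshift (lfree B) i) (rshift k j))//= ?lR ?lL//.
    by rewrite ltn_addr.
  by right; rewrite addnA leq_addr.
have -> : BB = \prod_(i < lfree B) \prod_(j < lfree B)
    if (i < j)%N && adj (unlabel B) (rshift k i) (rshift k j)
    then W (v (lsh k (lfree A) (k + i)%N), v (lsh k (lfree A) (k + j)%N)) else 1.
  apply: eq_bigr => i _; apply: eq_bigr => j _.
  rewrite (@adj_lmul_B _ _ _ (rshift k i) (rshift k j))//= ?lR//.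
    by rewrite !ltn_add2l.
  by right; rewrite addnA leq_addr.
by congr (_ * _); exact: mulrCA.
Qed.

Lemma nice_free_prod k (A : lgraph k) W h : graphon W -> nice (free_prod A W h).
Proof. by move=> gW; do 2![apply: nice_prod => ?]; exact: nice_graphon. Qed.

Lemma nice_label_prod k (S : {set 'I_k * 'I_k}) W : graphon W -> nice (label_prod S W).
Proof. by move=> gW; apply: nice_prod => ?; exact: nice_graphon. Qed.

Lemma label_prod_indep k (S : {set 'I_k * 'I_k}) W n : (k <= n)%N ->
  indep (label_prod S W) n.
Proof.
move=> kn v t; apply: eq_bigr => e _.
by rewrite !upd_neq// neq_ltn (leq_trans (ltn_ord _) kn).
Qed.

Lemma free_prod_indep k (A : lgraph k) W (h : nat -> nat) n :
  (forall i, (i < k + lfree A)%N -> h i != n) -> indep (free_prod A W h) n.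
Proof.
by move=> hn v t; apply: eq_bigr => i _; apply: eq_bigr => j _; rewrite !upd_neq ?hn.
Qed.

(** The density of the labeled graph with its labels pinned at [v], leaving out the edges between
    labels. *)
Definition free_density k (A : lgraph k) W v : R :=
  mint unif (iota k (lfree A)) (free_prod A W id) v.

Lemma nice_free_density k (A : lgraph k) W : graphon W -> nice (free_density A W).
Proof. by move=> gW; apply: nice_mint; exact: nice_free_prod. Qed.

Lemma free_density_shift k a (B : lgraph k) W v :
  mint unif (iota (k + a) (lfree B)) (free_prod B W (lsh k a)) v = free_density B W v.
Proof.
(* [l] renames the unlabeled nodes being integrated; [l'] records that the labels are pinned at the
   same coordinates on both sides. *)
pose l := [seq ((k + a + i)%N, (k + i)%N) | i <- iota 0 (lfree B)].
pose l' := [seq (i, i) | i <- iota 0 k].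
have l1 : unzip1 l = iota (k + a) (lfree B).
  by rewrite /unzip1 -map_comp -[(k + a)%N in RHS]addn0 iotaDl.
have l2 : unzip2 l = iota k (lfree B).
  by rewrite /unzip2 -map_comp; have := iotaDl k 0 (lfree B); rewrite addn0 => ->.
have l1' : unzip1 l' = iota 0 k by rewrite /unzip1 -map_comp map_id.
have l2' : unzip2 l' = iota 0 k by rewrite /unzip2 -map_comp map_id.
rewrite /free_density -l1 -l2; apply: (@mint_agree _ _ l l').
- rewrite /unzip1 map_cat -/(unzip1 _) -/(unzip1 _) l1 l1' cat_uniq !iota_uniq/= andbT.
  by apply/hasPn => i; rewrite !mem_iota; lia.
- rewrite /unzip2 map_cat -/(unzip2 _) -/(unzip2 _) l2 l2' cat_uniq !iota_uniq/= andbT.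
  by apply/hasPn => i; rewrite !mem_iota; lia.
- move=> v' w' /allP vw.
  have e (i : 'I_(k + lfree B)) : v' (lsh k a i) = w' i.
    rewrite /lsh; case: ltnP => ik.
      apply/eqP/(vw (val i, val i)); rewrite mem_cat; apply/orP; right.
      by apply/mapP; exists (val i); rewrite ?mem_iota.
    apply/eqP/(vw ((i + a)%N, val i)); rewrite mem_cat; apply/orP; left.
    apply/mapP; exists (i - k)%N; first by rewrite mem_iota; have := ltn_ord i; lia.
    by rewrite addnAC subnKC.
  by apply: eq_bigr => i _; apply: eq_bigr => j _; rewrite !e.
- by apply/allP => _ /mapP[i _ ->]; rewrite /=.
Qed.

(** For fixed labels the unlabeled nodes of the two factors occupy disjoint coordinates and are
    integrated independently; only the edges between labels remain coupled. *)
Lemma hom_density_lmul k (A B : lgraph k) W v : graphon W ->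
  hom_density (unlabel (lmul A B)) W =
  mint unif (iota 0 k) (fun v => label_prod (label_edges A :|: label_edges B) W v *
     (free_density A W v * free_density B W v)) v.
Proof.
move=> gW; rewrite (hom_density_place (h := val) v gW val_inj).
rewrite val_enum_ord /= iotaD add0n iotaD !mint_cat.
set S := label_edges A :|: label_edges B.
have -> : edge_prod (G := unlabel (lmul A B)) W val =
    fun v => (label_prod S W v * free_prod A W id v) * free_prod B W (lsh k (lfree A)) v.
  by apply/funext => w; rewrite edge_prod_lmul mulrA.
rewrite (mint_indep_mul _ (nice_free_prod B (lsh k (lfree A)) gW)
  (f := fun v => label_prod S W v * free_prod A W id v)); last first.
  move=> n; rewrite mem_iota => /andP[kn _] w t.
  rewrite label_prod_indep ?(leq_trans (leq_addr _ _) kn)// free_prod_indep// => i ik.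
  by rewrite neq_ltn (leq_trans ik kn).
have -> : mint unif (iota (k + lfree A) (lfree B)) (free_prod B W (lsh k (lfree A))) =
    free_density B W by apply/funext => w; exact: free_density_shift.
under [in LHS]eq_fun do rewrite mulrAC.
rewrite (mint_indep_mul _ (nice_free_prod A id gW)
  (f := fun v => label_prod S W v * free_density B W v)); last first.
  move=> n; rewrite mem_iota => /andP[kn nk] w t.
  rewrite label_prod_indep//; congr (_ * _).
  (* In shifted form the integrand of [free_density B] reads no coordinate of an unlabeled node of
     A, which makes the independence immediate. *)
  rewrite -(free_density_shift (lfree A)) -[RHS](free_density_shift (lfree A)).
  apply: indep_mint; apply: free_prod_indep => i _; rewrite /lsh.
  by case: ltnP => ik; lia.
by congr (mint _ _ _ v); apply/funext => w; rewrite -mulrA [X in _ * X]mulrC.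
Qed.

(** The probability that independent coins, one per ordered pair e with bias W(e), show heads
    exactly on [X]. *)
Definition induced_weight k (X : {set 'I_k * 'I_k}) W v : R :=
  \prod_e (if e \in X then W (v (val e.1), v (val e.2)) else 1 - W (v (val e.1), v (val e.2))).

(** Both sides are the probability that all coins of [S] show heads. The proof pads the product with
    factors w(e) + (1 - w(e)) outside [S] and expands. *)
Lemma label_prodE k (S : {set 'I_k * 'I_k}) W v :
  label_prod S W v = \sum_(X : {set 'I_k * 'I_k}) (S \subset X)%:R * induced_weight X W v.
Proof.
pose w (e : 'I_k * 'I_k) := W (v (val e.1), v (val e.2)).
transitivity (\prod_e (w e + (if e \in S then 0 else 1 - w e))).
  rewrite /label_prod big_mkcond; apply: eq_bigr => e _.
  by case: ifP; rewrite ?addr0// addrC subrK.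
rewrite bigA_distr; apply: eq_bigr => X _.
have [SX|/subsetPn[e eS eX]] := boolP (S \subset X).
  rewrite mul1r; apply: eq_bigr => e _; case: (boolP (e \in X)) => // eX.
  by rewrite ifN//; apply: contra eX => /(fintype.subsetP SX).
by rewrite mul0r (bigD1 e)//= (negbTE eX) eS mul0r.
Qed.

(* A graphon value [W e] is the probability of an edge, and a union of edge
   sets is contained in [X] iff both sets are; hence the quadratic form is a
   positive combination, over the outcomes [X], of squares. *)
Lemma qeval_lqsquare_ge0 k (y : lqgraph R k) W : graphon W ->
  0 <= qeval (lqsquare y) W.
Proof.
move=> gW; pose r := [seq (p, q) | p <- y, q <- y].
have -> : qeval (lqsquare y) W = \sum_(pq <- r) (pq.1.1 * pq.2.1) *
    mint unif (iota 0 k) (fun v => label_prod (label_edges pq.1.2 :|: label_edges pq.2.2) W v *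
     (free_density pq.1.2 W v * free_density pq.2.2 W v)) (fun=> 0).
  rewrite /qeval /lqsquare /r !big_allpairs_dep /=.
  apply: eq_bigr => p _; apply: eq_bigr => q _ /=.
  by rewrite (hom_density_lmul p.2 q.2 (fun=> 0) gW).
pose F (pq : (R * lgraph k) * (R * lgraph k)) v :=
  label_prod (label_edges pq.1.2 :|: label_edges pq.2.2) W v *
     (free_density pq.1.2 W v * free_density pq.2.2 W v).
have nF pq : nice (F pq).
  by apply: nice_mul; [exact: nice_label_prod|apply: nice_mul; exact: nice_free_density].
have := mint_sum unif (iota 0 k) r (fun pq => pq.1.1 * pq.2.1) nF.
move=> /(congr1 (fun f => f (fun=> 0))) <-; apply: mint_ge0 => v.
have -> : \sum_(pq <- r) pq.1.1 * pq.2.1 * F pq v =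
    \sum_(X : {set 'I_k * 'I_k}) induced_weight X W v *
      (\sum_(p <- y) p.1 * (label_edges p.2 \subset X)%:R * free_density p.2 W v) ^+ 2.
  rewrite /r big_allpairs_dep /=.
  under [RHS]eq_bigr do rewrite expr2 mulr_suml mulr_sumr.
  rewrite [RHS]exchange_big; apply: eq_bigr => p _.
  under [RHS]eq_bigr do rewrite mulr_sumr mulr_sumr.
  rewrite [RHS]exchange_big; apply: eq_bigr => q _ /=.
  rewrite /F /= label_prodE mulr_suml mulr_sumr; apply: eq_bigr => X _.
  by rewrite finset.subUset -mulnb natrM; ring.
apply: sumr_ge0 => X _; rewrite mulr_ge0 ?sqr_ge0//; apply: prodr_ge0 => e _.
have [_ _ /(_ (v (val e.1)) (v (val e.2)))/andP[w0 w1]] := gW.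
by case: ifP => // _; rewrite subr_ge0.
Qed.

End LabeledProducts.

(** * Step graphons *)

Lemma mint_prod {R : realType} (P : probability (measurableTypeR R) R) n (s : seq 'I_n)
    (F : 'I_n -> R -> R) v : uniq s ->
  (forall i, nice (fun v => F i (v (val i)))) ->
  mint P [seq val i | i <- s] (fun v => \prod_(i <- s) F i (v (val i))) v =
  \prod_(i <- s) (\int[P]_t F i t)%R.
Proof.
move=> + nF; elim: s v => [|i s IH] v; first by rewrite /= !big_nil.
rewrite /= => /andP[iNs us].
have -> : (fun v => \prod_(j <- i :: s) F j (v (val j))) =
    (fun v => F i (v (val i)) * \prod_(j <- s) F j (v (val j))).
  by apply/funext => w; rewrite big_cons.
rewrite mint_indep_mul; last 2 first.
- exact: nice_prod.
- move=> k ks w t; rewrite upd_neq//; apply: contraNneq iNs => ik.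
  by rewrite -ik mem_map in ks => //; exact: val_inj.
rewrite big_cons /cint; under eq_Rintegral do rewrite IH// upd_id.
have := nice_int P v (val i) (nF i) => /= iF; rewrite RintegralZr//.
by apply: eq_integrable iF => // t _; rewrite /= upd_id.
Qed.

Section StepGraphon.
Context {R : realType} (N : nat).
Let K := N.+1.
Let T := 'I_(K + 0).
Implicit Types (G : T -> R) (t : R) (a b : T).

Definition cell (a : T) : set R := `[(a%:R / K%:R)%R, (a.+1%:R / K%:R)%R[%classic.

(** The half-open cells cover only [0,1); every other point, including 1, is sent to node 0. *)
Definition block t : T := odflt ord0 [pick a | t \in cell a].

Let K0 : 0 < K%:R :> R. Proof. by rewrite ltr0n. Qed.

Lemma cell_uniq a b t : cell a t -> cell b t -> a = b.
Proof.
rewrite /cell /= !in_itv /= => /andP[a1 a2] /andP[b1 b2]; apply/val_inj => /=.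
have := le_lt_trans a1 b2; have := le_lt_trans b1 a2.
by rewrite !ltr_pM2r ?invr_gt0// !ltr_nat; lia.
Qed.

(** A constant plus indicators: the constant accounts for points outside all cells, and both
    measurability and the integral of a step function can be read off. *)
Lemma blockE G t :
  G (block t) = G ord0 + \sum_a (G a - G ord0) * \1_(cell a) t.
Proof.
rewrite /block; case: pickP => [a|no] /=.
  rewrite inE => ta; rewrite (bigD1 a)//= big1 => [|b ba].
    by rewrite indicE mem_set// mulr1 addr0 addrC subrK.
  rewrite indicE memNset ?mulr0// => tb.
  by rewrite (cell_uniq tb ta) eqxx in ba.
by rewrite big1 ?addr0// => a _; rewrite indicE no mulr0.
Qed.

Lemma measurable_cell a : measurable (cell a : set R).
Proof. exact: measurable_itv. Qed.

Lemma measurable_block G d (S : measurableType d) (x : S -> R) :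
  measurable_fun [set: S] x -> measurable_fun [set: S] (fun s => G (block (x s))).
Proof.
move=> mx; under eq_fun do rewrite blockE.
apply: measurable_funD => //; apply: measurable_sum => a.
apply: measurable_funM => //; apply: measurableT_comp mx.
by apply: measurable_indic; exact: measurable_cell.
Qed.

Lemma unif_cell a : unif (cell a) = (K%:R^-1)%:E.
Proof.
rewrite /unif /= /uniform_prob integral_uniform_pdf.
have ca : (cell a `&` `[0%R, 1%R])%classic = cell a.
  apply/setIidPl => t; rewrite /cell /= !in_itv /= => /andP[a0 a1].
  have a00 : 0 <= a%:R / K%:R :> R by rewrite divr_ge0.
  rewrite (le_trans a00 a0)/= (le_trans (ltW a1))// ler_pdivrMr// mul1r ler_nat.
  by have := ltn_ord a; lia.
rewrite ca (eq_integral (fun=> 1%E)) => [|t]; last first.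
  rewrite -ca inE => -[_]; rewrite /= in_itv /= /uniform_pdf => ->.
  by rewrite subr0 invr1.
rewrite integral_cst ?mul1e//=; last exact: measurable_cell.
rewrite lebesgue_measure_itv /= lte_fin ltr_pM2r ?invr_gt0// ltr_nat ltnSn.
by rewrite -EFinD -mulrBl -natrB// subSnn mul1r.
Qed.

Lemma int_indic_cell a : (\int[unif]_t (\1_(cell a) t : R))%R = K%:R^-1.
Proof.
rewrite /Rintegral integral_indic//; last exact: measurable_cell.
by rewrite setIT; have /= -> := unif_cell a.
Qed.

Lemma int_block G : (\int[unif]_t G (block t))%R = K%:R^-1 * \sum_a G a.
Proof.
(* The index [None] carries the constant term of [blockE], so that [cint_sum] treats the whole
   expression as one linear combination. *)
pose F (o : option T) (v : nat -> R) : R := if o is Some a then \1_(cell a) (v 0%N) else 1.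
pose c (o : option T) := if o is Some a then G a - G ord0 else G ord0.
have nF o : nice (F o).
  case: o => [a|]; last exact: nice1.
  split=> [v|d S x mx]; first by rewrite /F indicE ler0n lern1 leq_b1.
  by apply: measurableT_comp (mx _); by apply: measurable_indic; exact: measurable_cell.
have /(congr1 (fun f => f (fun=> 0))) :=
  cint_sum unif (None :: [seq Some a | a <- enum T]) c 0 nF.
rewrite big_cons big_map big_enum /= [in X in _ = X -> _]/cint.
under [X in _ = _ + X -> _]eq_bigr do rewrite int_indic_cell.
rewrite Rintegral_cst//; have /= -> := @probability_setT _ _ _ (@unif R).
rewrite -mulr_suml sumrB sumr_const card_ord [X in _ *+ X]addn0 /= => E.
transitivity (G ord0 * (1 * 1) + (\sum_a G a - G ord0 *+ K) / K%:R).
  rewrite -E /cint; apply: eq_Rintegral => t _.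
  by rewrite big_cons big_map big_enum /= mulr1 blockE.
rewrite mulrBl -(mulr_natr (G ord0)) mulfK ?gt_eqF//.
by rewrite !mulr1 addrC subrK mulrC.
Qed.

Definition step_graphon (M : T -> T -> bool) (p : R * R) : R :=
  (M (block p.1) (block p.2))%:R.

Lemma graphon_step M : (forall a b, M a b = M b a) -> graphon (step_graphon M).
Proof.
move=> Ms; split=> [|s t|s t]; last 1 first.
- by rewrite /step_graphon ler0n lern1 leq_b1.
- have -> : step_graphon M = fun p : R * R => \sum_(a : T)
      (M a (block p.2))%:R * (block p.1 == a)%:R.
    apply/funext => p; rewrite (bigD1 (block p.1))//= eqxx mulr1 big1 ?addr0// => a.
    by rewrite eq_sym => /negbTE ->; rewrite mulr0.
  apply: measurable_sum => a; apply: measurable_funM.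
    exact: (measurable_block (fun b => (M a b)%:R) measurable_snd).
  exact: (measurable_block (fun b => (b == a)%:R) measurable_fst).
- by rewrite /step_graphon /= Ms.
Qed.

(** On the box of points whose blocks are given by [phi] the integrand is constant, 1 or 0 according
    to whether [phi] sends edges into [M], and the box has measure K^-n for n nodes. *)
Lemma hom_density_step (F : graph) M : (forall a b, M a b = M b a) ->
  hom_density F (step_graphon M) =
  \sum_(phi : {ffun 'I_(gsize F) -> T}) K%:R^-1 ^+ gsize F *
    [forall i, forall j, adj F i j ==> M (phi i) (phi j)]%:R.
Proof.
move=> Ms; rewrite (hom_density_place (h := val) (fun=> 0) (graphon_step Ms) val_inj).
pose g (phi : {ffun 'I_(gsize F) -> T}) : R :=
  [forall i, forall j, adj F i j ==> M (phi i) (phi j)]%:R.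
pose D (phi : {ffun 'I_(gsize F) -> T}) (v : nat -> R) : R :=
  \prod_(i <- enum 'I_(gsize F)) (block (v (val i)) == phi i)%:R.
have nD1 (phi : {ffun 'I_(gsize F) -> T}) i :
    nice (fun v : nat -> R => (block (v (val i)) == phi i)%:R).
  split=> [v|d S x mx]; first by rewrite ler0n lern1 leq_b1.
  exact: (measurable_block (fun b => (b == phi i)%:R) (mx _)).
have nD phi : nice (D phi) by apply: nice_prod => i; exact: nD1.
have -> : edge_prod (G := F) (step_graphon M) val =
    fun v : nat -> R => \sum_(phi <- index_enum {ffun 'I_(gsize F) -> T}) g phi * D phi v.
  apply/funext => v; rewrite (bigD1 [ffun i : 'I_(gsize F) => block (v (val i))])//=.
  rewrite big1 ?addr0 => [|phi pv]; last first.
    have [i /eqP pi] : exists i, block (v (val i)) != phi i.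
      apply/existsP; apply: contraR pv => /existsPn pv; apply/eqP/ffunP => i.
      by rewrite ffunE; have /negbNE/eqP := pv i.
    rewrite /D (bigD1_seq i) ?mem_enum ?enum_uniq//=.
    by move/eqP: pi => /negbTE ->; rewrite mul0r mulr0.
  rewrite /D big1_seq ?mulr1 => [|i _]; last by rewrite ffunE eqxx.
  rewrite /g; case: forallP => [all|nall].
    rewrite /edge_prod big1// => i _; rewrite big1// => j /andP[_ ij].
    by move/forallP: (all i) => /(_ j); rewrite ij /= !ffunE /step_graphon /= => ->.
  have [i [j /andP[ij]]] : exists i j, adj F i j && ~~ M (block (v (val i))) (block (v (val j))).
    apply: contrapT => no; apply: nall => i; apply/forallP => j; apply/implyP => ij.
    by rewrite !ffunE; apply/negPn/negP => nM; apply: no; exists i, j; rewrite ij.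
  (* [edge_prod] lists each edge only in increasing order, so the violated edge must be oriented
     before its zero factor can be exhibited. *)
  wlog lij : i j ij / (i < j)%N => [th nM|nM].
    case: (ltngtP i j) => [ij'|ji|e]; first exact: (th i j).
      by apply: (th j i) => //; [rewrite adj_sym|rewrite Ms].
    by have := adj_neq ij; rewrite (ord_inj e) eqxx.
  rewrite /edge_prod (bigD1 i)//= (bigD1 j) ?lij//=.
  by rewrite /step_graphon /= (negbTE nM) !mul0r.
rewrite mint_sum//; apply: eq_bigr => phi _; rewrite mulrC; congr (_ * _).
rewrite (mint_prod unif (F := fun i t => (block t == phi i)%:R)) ?enum_uniq//.
under eq_bigr do rewrite (int_block (fun b => (b == phi _)%:R)).
rewrite big_enum /=.
transitivity (\prod_(i < gsize F) (K%:R^-1 : R)); last by rewrite prodr_const card_ord.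
apply: eq_bigr => i _; rewrite (bigD1 (phi i))//= eqxx big1 ?addr0 ?mulr1//.
by move=> b /negbTE ->.
Qed.

End StepGraphon.

(** * Idempotents of the union algebra *)

Section Moebius.
Context {R : realType} {E : finType}.
Implicit Types (A B H S U X : {set E}) (w : {set E} -> R).

(** The sum factors over the elements e: choosing e gives -[e in B], omitting it gives [e not in A].
    The factor vanishes as soon as e lies in exactly one of A and B. *)
Lemma sum_sign_interval A B :
  \sum_(X : {set E}) (A \subset X)%:R * (X \subset B)%:R * (-1) ^+ #|X| =
  (A == B)%:R * (-1) ^+ #|A| :> R.
Proof.
transitivity (\prod_(e : E) (- (e \in B)%:R + (e \notin A)%:R : R)).
  rewrite bigA_distr; apply: eq_bigr => X _.
  rewrite -natrM mulnb; case: (boolP (A \subset X)) => [AX|/subsetPn[e eA eX]]; last first.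
    by rewrite mul0r (bigD1 e)//= (negbTE eX) eA mul0r.
  case: (boolP (X \subset B)) => [XB|/subsetPn[e eX eB]]; last first.
    by rewrite mul0r (bigD1 e)//= eX (negbTE eB) oppr0 mul0r.
  rewrite mul1r -prodr_const [LHS]big_mkcond; apply: eq_bigr => e _.
  case: (boolP (e \in X)) => [eX|eX]; first by rewrite (fintype.subsetP XB).
  by rewrite (contra (fintype.subsetP AX e) eX).
have [<-|] := eqVneq A B.
  rewrite mul1r -prodr_const [RHS]big_mkcond; apply: eq_bigr => e _.
  by case: (e \in A); rewrite /= ?addr0// oppr0 add0r.
rewrite finset.eqEsubset negb_and mul0r => /orP[] /subsetPn[e eA eB].
  by rewrite (bigD1 e)//= eA (negbTE eB) oppr0 addr0 mul0r.
by rewrite (bigD1 e)//= eA eB addNr mul0r.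
Qed.

(** Moebius inversion over supersets. With [w] extended linearly to combinations of edge sets, this
    is its value at the idempotent of [H]. *)
Definition moebius w H : R := \sum_(U : {set E}) (H \subset U)%:R * (-1) ^+ (#|H| + #|U|) * w U.

Lemma sum_moebius w S : \sum_(X : {set E}) (S \subset X)%:R * moebius w X = w S.
Proof.
under eq_bigr do rewrite /moebius mulr_sumr.
rewrite exchange_big /=.
transitivity (\sum_(U : {set E}) (S == U)%:R * (-1) ^+ #|S| * ((-1) ^+ #|U| * w U)).
  apply: eq_bigr => U _; rewrite -sum_sign_interval mulr_suml; apply: eq_bigr => X _.
  by rewrite exprD; ring.
rewrite (bigD1 S)//= eqxx big1 ?addr0 => [|U]; last first.
  by rewrite eq_sym => /negbTE ->; rewrite !mul0r.
by rewrite mul1r mulrA -expr2 sqrr_sign mul1r.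
Qed.

(* Expanding [w] over the multiplicative functions [S |-> (S \subset X)] shows
   that the alternating sums of the supersets of [H] are idempotent for the
   union product. *)
Lemma sum_moebius_sqr w H :
  \sum_(S : {set E}) \sum_(S' : {set E})
     ((H \subset S)%:R * (-1) ^+ (#|H| + #|S|)) * ((H \subset S')%:R * (-1) ^+ (#|H| + #|S'|))
       * w (S :|: S') = moebius w H.
Proof.
pose c (S : {set E}) : R := (H \subset S)%:R * (-1) ^+ (#|H| + #|S|).
have sc X : \sum_(S : {set E}) c S * (S \subset X)%:R = (H == X)%:R.
  transitivity ((-1) ^+ #|H| * ((H == X)%:R * (-1) ^+ #|H|) : R).
    rewrite -sum_sign_interval mulr_sumr; apply: eq_bigr => S _.
    by rewrite /c exprD; ring.
  by rewrite mulrCA -expr2 sqrr_sign mulr1.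
move: (moebius w) (sum_moebius w) => om omw.
transitivity (\sum_(X : {set E}) om X * (\sum_(S : {set E}) c S * (S \subset X)%:R) ^+ 2).
  under [RHS]eq_bigr do rewrite expr2 mulr_suml mulr_sumr.
  rewrite [RHS]exchange_big; apply: eq_bigr => S _.
  under [RHS]eq_bigr do rewrite mulr_sumr mulr_sumr.
  rewrite [RHS]exchange_big; apply: eq_bigr => S' _ /=.
  rewrite -[in LHS]omw mulr_sumr; apply: eq_bigr => X _.
  by rewrite finset.subUset -mulnb natrM /c; ring.
rewrite (bigD1 H)//= sc eqxx expr1n mulr1 big1 ?addr0// => X.
by rewrite sc eq_sym => /negbTE ->; rewrite expr0n mulr0.
Qed.

End Moebius.

(** * Images of graphs on labeled nodes *)

Section Approximation.
Context {R : realType} (N : nat).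
Let K := N.+1.
Let T := 'I_(K + 0).
Implicit Types (F : graph) (S H : {set T * T}).

Definition image_edges F (phi : 'I_(gsize F) -> T) : {set T * T} :=
  [set p : T * T | (p.1 < p.2)%N &
     [exists i, exists j, [&& adj F i j, phi i == p.1 & phi j == p.2]]]%SET.

(* Equal endpoints count as adjacent because [image_edges] drops loops. *)
Definition edge_pred H (a b : T) :=
  [|| a == b, (a < b)%N && ((a, b) \in H) | (b < a)%N && ((b, a) \in H)].

Lemma edge_pred_sym H a b : edge_pred H a b = edge_pred H b a.
Proof. by rewrite /edge_pred eq_sym; congr (_ || _); rewrite orbC. Qed.

(** Turns the maps counted by [hom_density_step] into the multiplicative functions S |->
    [S is contained in H] of Moebius inversion. An edge collapsed to a single node imposes no
    condition on either side. *)
Lemma image_edges_sub F (phi : 'I_(gsize F) -> T) H :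
  [forall i, forall j, adj F i j ==> edge_pred H (phi i) (phi j)] =
  (image_edges phi \subset H).
Proof.
apply/forallP/fintype.subsetP => [all [a b]|sub i].
  rewrite inE /= => /andP[ab /existsP[i /existsP[j /and3P[ij /eqP ia /eqP jb]]]].
  move/forallP: (all i) => /(_ j); rewrite ij ia jb /edge_pred /= ab.
  by rewrite -(inj_eq val_inj) /= ltn_eqF// ltnNge ltnW//= orbF.
apply/forallP => j; apply/implyP => ij; rewrite /edge_pred.
have mem i' j' : adj F i' j' -> (phi i' < phi j')%N -> (phi i', phi j') \in H.
  move=> ij' lt; apply: sub; rewrite inE /= lt /=.
  by apply/existsP; exists i'; apply/existsP; exists j'; rewrite ij' !eqxx.
case: (ltngtP (phi i) (phi j)) => [lt|lt|/ord_inj ->]; last by rewrite eqxx.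
  by rewrite /= mem// orbT.
by rewrite /= (mem j i) ?orbT// adj_sym.
Qed.

Lemma image_graph_gequiv F (phi : 'I_(gsize F) -> T) : injective phi ->
  gequiv F (Graph (image_edges phi)).
Proof.
move=> phiI; apply: (@gequiv_inj F (Graph (image_edges phi)) phi) => //.
  move=> i j; rewrite /adj /= !inE /= (inj_eq phiI).
  have ex i' j' : [exists i0, exists j0, [&& adj F i0 j0, phi i0 == phi i' & phi j0 == phi j']]
      = adj F i' j'.
    apply/existsP/idP => [[i0 /existsP[j0 /and3P[a /eqP/phiI <- /eqP/phiI <-]]]//|a].
    by exists i'; apply/existsP; exists j'; rewrite a !eqxx.
  rewrite !ex [adj F j i]adj_sym -andb_orl -neq_ltn.
  case: (eqVneq i j) => [->|ij]; rewrite ?eqxx//=.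
  have -> : (phi i : nat) != phi j by apply: contraNneq ij => /ord_inj/phiI ->.
  by rewrite /adj ij.
move=> b /existsP[a]; rewrite /adj /= !inE /= => /andP[_].
by move=> /orP[] /andP[_ /existsP[i /existsP[j /and3P[_ /eqP ib /eqP jb]]]]; [exists i|exists j].
Qed.

Definition lset S : lgraph K := @LGraph K 0 S.

Lemma lmul_lset_gequiv S S' :
  gequiv (unlabel (lmul (lset S) (lset S'))) (Graph (S :|: S')).
Proof.
apply: (@gequiv_inj (unlabel (lmul (lset S) (lset S'))) (Graph (S :|: S')) id) => //.
  move=> i j; rewrite /adj; congr (_ && _).
  rewrite [in RHS](in_lmul (A := lset S) (B := lset S') i j).
  rewrite [in RHS](in_lmul (A := lset S) (B := lset S') j i) !inE.
  have lsh0 x : lsh K 0 x = x by rewrite /lsh addn0; case: ifP.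
  have e1 (X : {set T * T}) (x y : T) :
      [exists p in X, (val p.1 == val x) && (val p.2 == val y)] = ((x, y) \in X).
    by apply: (exists_val_pair _ (f := id)) => //; exact: inj_id.
  have e2 (X : {set T * T}) (x y : T) :
      [exists p in X, (lsh K 0 p.1 == x) && (lsh K 0 p.2 == y)] = ((x, y) \in X).
    by apply: exists_val_pair; [exact: lsh_inj|exact: lsh0|exact: lsh0].
  by rewrite (e1 S i j) (e1 S j i) (e2 S' i j) (e2 S' j i).
by move=> j _; exists j.
Qed.

End Approximation.

(** * Sums of squares *)

(** The collision bound n^2/K with denominators cleared: injectivity of the first n values costs
    n^2/K by induction, and the next value hits one of them with probability at most n/K. *)
Lemma noninj_card_le (R : realType) (n K : nat) :
  K%:R * (K%:R ^+ n - (K ^_ n)%:R) <= n%:R ^+ 2 * K%:R ^+ n :> R.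
Proof.
elim: n => [|n IH]; first by rewrite ffactn0 expr0 subrr mulr0 mulr_ge0.
have K0 : 0 <= K%:R :> R by [].
have n0 : 0 <= n%:R :> R by [].
have le1 : (K ^_ n)%:R <= K%:R ^+ n :> R.
  rewrite -natrX ler_nat; elim: n {IH n0} => // m IH.
  by rewrite ffactnSr expnSr leq_mul// leq_subr.
(* Only an inequality: for n > K the subtraction in the falling factorial truncates to 0 while the
   real one is negative. *)
have le2 : (K ^_ n)%:R * (K%:R - n%:R) <= (K ^_ n.+1)%:R :> R.
  rewrite ffactnSr natrM; apply: ler_wpM2l => //; rewrite lerBlDr -natrD ler_nat.
  by rewrite addnC -leq_subLR.
have f0 : 0 <= (K ^_ n)%:R :> R by [].
rewrite exprS -natr1.
move: IH le1 le2 K0 n0 f0; move: (K%:R ^+ n) (K ^_ n)%:R (K ^_ n.+1)%:R.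
move: (K%:R : R) (n%:R : R) => k m P f g IH le1 le2 k0 m0 f0.
have h1 : k * (k * P - g) <= k * (k * P - f * (k - m)).
  by apply: ler_wpM2l => //; rewrite lerB.
have h2 : k * (k * (P - f)) <= k * (m ^+ 2 * P) by apply: ler_wpM2l.
have h3 : k * m * f <= k * m * P by apply: ler_wpM2l => //; exact: mulr_ge0.
(* The slack left over, (m + 1)^2 - m^2 - m = m + 1, times [k * P]. *)
have h4 : 0 <= (m + 1) * (k * P) by rewrite !mulr_ge0// ?addr_ge0// (le_trans f0).
apply: le_trans h1 _; nra.
Qed.

Section Sufficiency.
Context {R : realType}.
Implicit Types (x : qgraph R) (F : graph).

Lemma qcoefE x F : qcoef x F = \sum_(p <- x) p.1 * (gequiv p.2 F)%:R.
Proof.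
rewrite /qcoef big_mkcond; apply: eq_bigr => p _.
by case: ifP; rewrite ?mulr1 ?mulr0.
Qed.

Lemma qcoef_qsub x y F : qcoef (qsub x y) F = qcoef x F - qcoef y F.
Proof.
rewrite !qcoefE /qsub big_cat big_map /= -sumrN; congr (_ + _).
by apply: eq_bigr => p _; rewrite mulNr.
Qed.

Lemma qeval_qsub x y W : qeval (qsub x y) W = qeval x W - qeval y W.
Proof.
rewrite /qeval /qsub big_cat big_map /= -sumrN; congr (_ + _).
by apply: eq_bigr => p _; rewrite mulNr.
Qed.

Section Level.
Variable N : nat.
Let K := N.+1.
Let T := 'I_(K + 0).
Implicit Types (S H : {set T * T}) (c : {set T * T} -> R).

(** The idempotent of [H] scaled by the square root of [c H]; its square is therefore [c H] times
    that idempotent. *)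
Definition weighted_root c H : lqgraph R K :=
  [seq (Num.sqrt (c H) * ((H \subset A)%:R * (-1) ^+ (#|H| + #|A|)), lset A)
     | A : {set T * T} <- index_enum {set T * T}].

Lemma qcoef_sum_squares c F : (forall H, 0 <= c H) ->
  qcoef (sum_squares [seq weighted_root c H | H : {set T * T} <- index_enum {set T * T}]) F =
  \sum_H c H * moebius (fun S => (gequiv (Graph S) F)%:R) H.
Proof.
move=> c0; rewrite qcoefE big_flatten /= !big_map; apply: eq_bigr => H _.
rewrite big_allpairs_dep /weighted_root big_map -sum_moebius_sqr mulr_sumr.
apply: eq_bigr => S _; rewrite big_map mulr_sumr; apply: eq_bigr => S' _ /=.
rewrite (gequiv_eq _ (lmul_lset_gequiv S S')) -{3}(sqr_sqrtr (c0 H)).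
by rewrite expr2; move: (Num.sqrt _) => s; ring.
Qed.

(** The difference between [x] and its average over maps into the labels, with the injective maps
    already cancelled: each remaining map leaves its graph and, with opposite sign, the image. *)
Definition blowup_error x : qgraph R :=
  flatten [seq flatten [seq
     [:: (p.1 * K%:R^-1 ^+ gsize p.2 * (~~ injectiveb phi)%:R, p.2);
         (- (p.1 * K%:R^-1 ^+ gsize p.2 * (~~ injectiveb phi)%:R),
           Graph (image_edges phi))]
     | phi : {ffun 'I_(gsize p.2) -> T} <- index_enum {ffun 'I_(gsize p.2) -> T}] | p <- x].

Lemma sum_ffun_const n (y : R) :
  \sum_(phi : {ffun 'I_n -> T}) K%:R^-1 ^+ n * y = y.
Proof.
rewrite sumr_const card_ffun !card_ord addn0 -[LHS]mulr_natl mulrA natrX -exprMn.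
by rewrite divff ?expr1n ?mul1r// pnatr_eq0.
Qed.

(** Exchanging sums leaves, for each map, the Moebius expansion of [w] at its image, so the sum of
    squares has exactly the coefficients of the averaged [x]. *)
Lemma qcoef_blowup_error x F (c := fun H => qeval x (step_graphon (edge_pred H))) :
  (forall H, 0 <= c H) ->
  qcoef (qsub x (sum_squares [seq weighted_root c H | H : {set T * T} <- index_enum {set T * T}])) F =
  qcoef (blowup_error x) F.
Proof.
move=> c0; rewrite qcoef_qsub qcoef_sum_squares// 2!qcoefE big_flatten big_map /=.
pose w S : R := (gequiv (Graph S) F)%:R.
have -> : \sum_H c H * moebius w H = \sum_(p <- x) \sum_(phi : {ffun 'I_(gsize p.2) -> T})
    p.1 * K%:R^-1 ^+ gsize p.2 * w (image_edges phi).
  transitivity (\sum_(H : {set T * T}) \sum_(p <- x) \sum_(phi : {ffun 'I_(gsize p.2) -> T})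
     p.1 * K%:R^-1 ^+ gsize p.2 * ((image_edges phi \subset H)%:R * moebius w H)).
    apply: eq_bigr => H _; rewrite /c /qeval mulr_suml; apply: eq_bigr => p _.
    rewrite hom_density_step; last exact: edge_pred_sym.
    move: (moebius w H) => m; rewrite mulr_sumr mulr_suml; apply: eq_bigr => phi _.
    by rewrite image_edges_sub !mulrA.
  rewrite exchange_big; apply: eq_bigr => p _; rewrite exchange_big; apply: eq_bigr => phi _ /=.
  by rewrite -mulr_sumr sum_moebius.
rewrite -sumrB; apply: eq_bigr => p _.
(* The coefficient in [x] is itself written as an average over maps, so that the two sides compare
   map by map. *)
rewrite big_flatten big_map /= -[X in X - _](sum_ffun_const (gsize p.2)) -sumrB.
apply: eq_bigr => phi _; rewrite !big_cons big_nil /= addr0 -/(w _).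
case: (boolP (injectiveb phi)) => [/injectiveP phiI|_].
  rewrite !mulr0 oppr0 !mul0r addr0 /w -(gequiv_eq _ (image_graph_gequiv phiI)).
  by ring.
by rewrite /=; ring.
Qed.

Lemma sum_noninj n :
  \sum_(phi : {ffun 'I_n -> T}) K%:R^-1 ^+ n * (~~ injectiveb phi)%:R <= n%:R ^+ 2 / K%:R :> R.
Proof.
have K0 : 0 < K%:R :> R by rewrite ltr0n.
rewrite -mulr_sumr.
have -> : \sum_(phi : {ffun 'I_n -> T}) (~~ injectiveb phi)%:R = K%:R ^+ n - (K ^_ n)%:R :> R.
  have cT : #|T| = K by rewrite card_ord addn0.
  have := card_inj_ffuns 'I_n T; rewrite cT card_ord => <-.
  apply/eqP; rewrite eq_sym subr_eq; apply/eqP.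
  transitivity (\sum_(phi : {ffun 'I_n -> T}) (1 : R)).
    by rewrite sumr_const card_ffun cT card_ord -natrX.
  rewrite -sum1_card natr_sum [X in _ + X]big_mkcond -big_split /=.
  by apply: eq_bigr => phi _; rewrite inE; case: injectiveb; rewrite ?add0r ?addr0.
rewrite exprVn ler_pdivlMr// mulrAC -mulrA ler_pdivrMl ?exprn_gt0//.
by rewrite [X in _ <= X]mulrC noninj_card_le.
Qed.

Lemma norm_blowup_error x : \sum_(p <- blowup_error x) `|p.1| <=
  (\sum_(p <- x) 2 * `|p.1| * (gsize p.2)%:R ^+ 2) / K%:R.
Proof.
rewrite big_flatten big_map mulr_suml; apply: ler_sum => p _.
rewrite big_flatten big_map /=.
rewrite -mulrA; apply: le_trans (ler_wpM2l _ (sum_noninj (gsize p.2))); last first.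
  by rewrite mulr_ge0.
rewrite mulr_sumr; apply: ler_sum => phi _; rewrite !big_cons big_nil /= addr0 normrN.
rewrite !normrM (ger0_norm (ler0n _ _)).
by rewrite (@ger0_norm _ (K%:R^-1 ^+ _)) ?exprn_ge0 ?invr_ge0// le_eqVlt; apply/orP; left; apply/eqP; ring.
Qed.

End Level.

Lemma qnonneg_approx x eps : qnonneg x -> 0 < eps ->
  exists (k : nat) (ys : seq (lqgraph R k)),
    (1 <= k)%N /\ qnorm1 (qsub x (sum_squares ys)) < eps.
Proof.
move=> x0 e0; pose C : R := \sum_(p <- x) 2 * `|p.1| * (gsize p.2)%:R ^+ 2.
have C0 : 0 <= C by apply: sumr_ge0 => p _; rewrite !mulr_ge0.
pose N := Num.bound (C / eps).
(* The choice of [N] gives C/eps < N < N + 1, hence an error C/(N + 1) below eps. [c] is nonnegative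
   by the hypothesis on [x], which is what allows the square roots. *)
pose c (H : {set 'I_(N.+1 + 0) * 'I_(N.+1 + 0)}) := qeval x (step_graphon (edge_pred H)).
have c0 H : 0 <= c H by apply: x0; apply: graphon_step; exact: edge_pred_sym.
exists N.+1, [seq weighted_root c H | H <- index_enum _]; split=> //.
have K0 : 0 < N.+1%:R :> R by rewrite ltr0n.
apply: le_lt_trans (qnorm1_le (fun F => qcoef_blowup_error F c0)) _.
apply: le_lt_trans (norm_blowup_error _ _) _.
rewrite ltr_pdivrMr// mulrC -ltr_pdivrMr//.
by apply: lt_trans (archi_boundP _) _; rewrite ?divr_ge0 ?ltr_nat// ltW.
Qed.

End Sufficiency.

Lemma approx_qnonneg (R : realType) (x : qgraph R) :
  (forall eps : R, 0 < eps -> exists (k : nat) (ys : seq (lqgraph R k)),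
     (1 <= k)%N /\ qnorm1 (qsub x (sum_squares ys)) < eps) -> qnonneg x.
Proof.
move=> ap W gW; rewrite leNgt; apply/negP => xW.
(* If [x] is negative at [W], subtracting squares only lowers the value further, so no approximation
   can come closer than [- qeval x W]. *)
have [|k [ys [_ n1]]] := ap (- qeval x W); first by rewrite oppr_gt0.
have sq : 0 <= qeval (sum_squares ys) W.
  rewrite /qeval big_flatten big_map; apply: sumr_ge0 => y _.
  exact: qeval_lqsquare_ge0.
have := le_lt_trans (normr_qeval_le (qsub x (sum_squares ys)) gW) n1.
rewrite qeval_qsub ltr0_norm; last by rewrite subr_lt0 (lt_le_trans xW).
by rewrite opprB ltrBlDl subrr ltNge sq.
Qed.

Theorem theorem4p1 (R : realType) (x : qgraph R) :
  qnonneg x <->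
  (forall eps : R, 0 < eps ->
     exists (k : nat) (ys : seq (lqgraph R k)),
       (1 <= k)%N /\ qnorm1 (qsub x (sum_squares ys)) < eps).
Proof. by split=> [x0 eps|]; [exact: qnonneg_approx|exact: approx_qnonneg]. Qed.
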